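(* Let $(R,\mathfrak m,\mathsf k)$ be a commutative Noetherian local Gorenstein ring with maximal ideal $\mathfrak m$ and residue field $\mathsf k=R/\mathfrak m$, such that $\mathfrak m^3=0\ne\mathfrak m^2$, and set $e=\nu(\mathfrak m)$. If $e>2$ and $M$, $N$ are finitely generated $R$-modules, then the following hold: (1) $\mathfrak m\operatorname{Tor}_i^R(M,N)=0$ for all $i\gg 0$; (2) $\mathfrak m\operatorname{Ext}^i_R(M,N)=0$ for all $i\gg 0$; (3) $(1-et+t^2)\cdot\sum_{i=0}^\infty \nu\left(\operatorname{Tor}_i^R(M,N)\right)t^i\in\mathbb Z[t]$; (4) $(1-et+t^2)\cdot\sum_{i=0}^\infty \nu\left(\operatorname{Ext}^i_R(M,N)\right)t^i\in\mathbb Z[t]$.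
   Context: For a finitely generated $R$-module $L$, $\nu(L)=\operatorname{rank}_{\mathsf k}(L/\mathfrak m L)$ denotes the minimal number of generators of $L$; in particular $\nu(\mathfrak m)=\operatorname{rank}_{\mathsf k}(\mathfrak m/\mathfrak m^2)$. The products in (3) and (4) are taken in the ring of formal power series $\mathbb Z[[t]]$. *)

(* Defs.v *)
From HB Require Import structures.
From mathcomp Require Import all_boot all_order all_algebra.
From mathcomp Require Import all_classical.
From mathcomp.multinomials Require Import freeg.

Set Implicit Arguments.
Unset Strict Implicit.
Unset Printing Implicit Defensive.

Import GRing.Theory.

Local Open Scope classical_set_scope.
Local Open Scope ring_scope.
Local Open Scope quotient_scope.

Section Span.
Variables (R : pzRingType) (V : lmodType R).

Definition span (A : set V) : {pred V} := fun v =>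
  `[< exists n (c : 'I_n -> R) (a : 'I_n -> V),
        (forall i, A (a i)) /\ v = \sum_(i < n) c i *: a i >].

Lemma span_submod_closed A : submod_closed (span A).
Proof.
split=> [|k u v].
  by apply/asboolP; exists 0%N, (fun=> 0), (fun=> 0); split=> [[]//|]; rewrite big_ord0.
move=> /asboolP[n [c [a [Aa ->]]]] /asboolP[p [d [b [Ab ->]]]]; apply/asboolP.
exists (n + p)%N, (fun i => match fintype.split i with inl j => k * c j | inr j => d j end).
exists (fun i => match fintype.split i with inl j => a j | inr j => b j end); split.
  by move=> i; case: (fintype.split i).
rewrite big_split_ord /= scaler_sumr; congr (_ + _); apply: eq_bigr => i _.
  by rewrite (unsplitK (inl i)) scalerA.
by rewrite (unsplitK (inr i)).
Qed.

HB.instance Definition _ A := GRing.isSubmodClosed.Build R V (span A)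
  (GRing.submod_closed_semi (span_submod_closed A)).

Lemma span_gen A v : A v -> v \in span A.
Proof.
move=> Av; apply/asboolP; exists 1%N, (fun=> 1), (fun=> v); split=> //.
by rewrite big_ord1 scale1r.
Qed.

(* I S, the submodule generated by the products a v with a in I and v in S. *)
Definition prod_submod (I : {pred R}) (S : {pred V}) : {pred V} :=
  span [set w | exists a v, [/\ a \in I, v \in S & w = a *: v]].

HB.instance Definition _ I S := GRing.SubmodClosed.on (prod_submod I S).

Definition fin_gen (S : {pred V}) : Prop :=
  exists s : seq V, S =i span [set v | v \in s].

End Span.

Section SubModule.
Variables (R : pzRingType) (V : lmodType R) (S : submodClosed V).

Record submod := Submod { submod_val :> V; submodP : submod_val \in S }.

HB.instance Definition _ := [isSub for submod_val].
HB.instance Definition _ := [Choice of submod by <:].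
HB.instance Definition _ := [SubChoice_isSubLmodule of submod by <:].

End SubModule.

Section QuotientModule.
Variables (R : pzRingType) (V : lmodType R) (S : submodClosed V).

(* submodClosed does not record closure under opposite, needed for quotients. *)
Fact submod_zmod_closed : zmod_closed (S : {pred V}).
Proof. exact/GRing.submod_closedB/submodClosedP. Qed.

Definition zmod_of_submod : zmodClosed V :=
  HB.pack_for (zmodClosed V) (S : {pred V})
    (GRing.isZmodClosed.Build V (GRing.SubmodClosed.sort S) submod_zmod_closed).

Definition quot_mod : Type := Quotient.quot zmod_of_submod.

HB.instance Definition _ := GRing.Zmodule.on quot_mod.

Definition to_quot (v : V) : quot_mod := \pi_(Quotient.quot zmod_of_submod) v.

Lemma to_quot_eq u v : to_quot u = to_quot v <-> u - v \in S.
Proof.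
have -> : (u - v \in S) = (u - v \in zmod_of_submod) by [].
by rewrite Quotient.idealrBE; split=> [/eqP|/eqP].
Qed.

Definition quot_repr (x : quot_mod) : V :=
  repr (x : Quotient.quot zmod_of_submod).

Lemma to_quotK x : to_quot (quot_repr x) = x.
Proof. exact: reprK. Qed.

Lemma to_quotD : {morph to_quot : u v / u + v}.
Proof. by move=> u v; rewrite /to_quot !piE. Qed.

Definition quot_scale (a : R) (x : quot_mod) : quot_mod :=
  to_quot (a *: quot_repr x).

Lemma quot_scaleE a v : quot_scale a (to_quot v) = to_quot (a *: v).
Proof.
by apply/to_quot_eq; rewrite -scalerBr rpredZ //; apply/to_quot_eq/to_quotK.
Qed.

Fact quot_scaleA a b x : quot_scale a (quot_scale b x) = quot_scale (a * b) x.
Proof. by rewrite -[x]to_quotK !quot_scaleE scalerA. Qed.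
Fact quot_scale1 : left_id 1 quot_scale.
Proof. by move=> x; rewrite -[x]to_quotK quot_scaleE scale1r. Qed.
Fact quot_scaleDr : right_distributive quot_scale +%R.
Proof.
move=> a x y; rewrite -[x]to_quotK -[y]to_quotK.
by rewrite -to_quotD !quot_scaleE scalerDr to_quotD.
Qed.
Fact quot_scaleDl x : {morph quot_scale^~ x : a b / a + b}.
Proof. by move=> a b; rewrite -[x]to_quotK !quot_scaleE scalerDl to_quotD. Qed.

HB.instance Definition _ := GRing.Zmodule_isLmodule.Build R quot_mod
  quot_scaleA quot_scale1 quot_scaleDr quot_scaleDl.

Fact to_quot_linear : linear to_quot.
Proof. by move=> a u v; rewrite to_quotD -quot_scaleE. Qed.
HB.instance Definition _ :=
  GRing.isLinear.Build R V quot_mod *:%R to_quot to_quot_linear.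

End QuotientModule.

Section Homology.
Variables (R : pzRingType) (U V W : lmodType R).

Definition exact_at (f : {linear U -> V}) (g : {linear V -> W}) : Prop :=
  forall v, g v = 0 <-> exists u, f u = v.

Definition ker_pred (g : {linear V -> W}) : {pred V} := fun v => g v == 0.

Fact ker_submod_closed g : submod_closed (ker_pred g).
Proof.
split=> [|a u v]; rewrite !unfold_in /= ?raddf0 //.
by rewrite linearP => /eqP-> /eqP->; rewrite scaler0 addr0.
Qed.
HB.instance Definition _ g := GRing.isSubmodClosed.Build R V (ker_pred g)
  (GRing.submod_closed_semi (ker_submod_closed g)).

Definition ker_mod (g : {linear V -> W}) : lmodType R := submod (ker_pred g).

Definition bnd_pred (f : {linear U -> V}) (g : {linear V -> W}) :
    {pred ker_mod g} :=
  fun z => `[< exists u, f u = val z >].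

Arguments bnd_pred f g z : clear implicits.

Fact bnd_submod_closed f g : submod_closed (bnd_pred f g).
Proof.
split=> [|a u v]; first by apply/asboolP; exists 0; rewrite !raddf0.
move=> /asboolP[x fx] /asboolP[y fy]; apply/asboolP; exists (a *: x + y).
by rewrite linearP fx fy.
Qed.
HB.instance Definition _ f g := GRing.isSubmodClosed.Build R (ker_mod g)
  (bnd_pred f g) (GRing.submod_closed_semi (bnd_submod_closed f g)).

(* ker g / im f, for U -f-> V -g-> W with g f = 0. *)
Definition homology (f : {linear U -> V}) (g : {linear V -> W}) : lmodType R :=
  quot_mod (bnd_pred f g).

End Homology.

Section Free.
Variables (R : comNzRingType) (X : choiceType) (V : lmodType R) (f : X -> V).

Definition free_lift (D : {freeg X / R}) : V := fglift f D.

Fact free_lift_linear : linear free_lift.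
Proof.
pose h := GRing.isZmodMorphism.Build _ _ free_lift (lift_is_additive f).
pose H : {additive {freeg X / R} -> V} := HB.pack free_lift h.
move=> a D E; rewrite -[free_lift]/(H : _ -> _) raddfD; congr (_ + _).
have -> : H D = H (\sum_(z <- dom D) << coeff z D *g z >>) by rewrite freeg_sumE.
rewrite -[a *: D]/(fgscale a D) /fgscale.
rewrite (raddf_sum H) (raddf_sum H) scaler_sumr; apply: eq_bigr => x _.
by rewrite /= /free_lift !liftU scalerA.
Qed.
HB.instance Definition _ :=
  GRing.isLinear.Build R {freeg X / R} V *:%R free_lift free_lift_linear.

Lemma free_liftE x : free_lift << x >> = f x.
Proof. by rewrite /free_lift liftU scale1r. Qed.

End Free.

Lemma free_linear_ext (R : comNzRingType) (X : choiceType) (V : lmodType R)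
    (g h : {linear {freeg X / R} -> V}) :
  (forall x, g << x >> = h << x >>) -> g =1 h.
Proof.
move=> gh D; rewrite -(freeg_sumE D) !linear_sum; apply: eq_bigr => x _.
have -> : << coeff x D *g x >> = coeff x D *: << x >> :> {freeg X / R}.
  by apply/eqP/freeg_eqP => y; rewrite coeffZ !coeffU mul1r.
by rewrite !linearZ_LR gh.
Qed.

Section Tensor.
Variables (R : comNzRingType) (M N : lmodType R).

Inductive tensor_rel : {freeg (M * N)%type / R} -> Prop :=
| tensor_relDl x x' y :
    tensor_rel (<< (x + x', y) >> - << (x, y) >> - << (x', y) >>)
| tensor_relDr x y y' :
    tensor_rel (<< (x, y + y') >> - << (x, y) >> - << (x, y') >>)
| tensor_relZl a x y : tensor_rel (<< (a *: x, y) >> - a *: << (x, y) >>)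
| tensor_relZr a x y : tensor_rel (<< (x, a *: y) >> - a *: << (x, y) >>).

Definition tensor : lmodType R := quot_mod (span tensor_rel).

Definition tensor_pure (x : M) (y : N) : tensor :=
  to_quot (span tensor_rel) << (x, y) >>.

Lemma tensor_pureDl x x' y :
  tensor_pure (x + x') y = tensor_pure x y + tensor_pure x' y.
Proof.
rewrite -to_quotD; apply/to_quot_eq; rewrite opprD addrA.
exact/span_gen/tensor_relDl.
Qed.

Lemma tensor_pureDr x y y' :
  tensor_pure x (y + y') = tensor_pure x y + tensor_pure x y'.
Proof.
rewrite -to_quotD; apply/to_quot_eq; rewrite opprD addrA.
exact/span_gen/tensor_relDr.
Qed.

Lemma tensor_pureZl a x y : tensor_pure (a *: x) y = a *: tensor_pure x y.
Proof.
by rewrite -linearZ; apply/to_quot_eq; apply/span_gen/tensor_relZl.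
Qed.

Lemma tensor_pureZr a x y : tensor_pure x (a *: y) = a *: tensor_pure x y.
Proof.
by rewrite -linearZ; apply/to_quot_eq; apply/span_gen/tensor_relZr.
Qed.

End Tensor.

Section TensorMap.
Variables (R : comNzRingType) (M M' N : lmodType R) (f : {linear M -> M'}).

(* f (x) id_N *)
Definition tensor_map (t : tensor M N) : tensor M' N :=
  free_lift (fun xy => tensor_pure (f xy.1) xy.2)
    (quot_repr t).

Let lft : {linear {freeg (M * N)%type / R} -> tensor M' N} :=
  free_lift (fun xy : M * N => tensor_pure (f xy.1) xy.2).

Fact tensor_map_quot D : tensor_map (to_quot _ D) = lft D.
Proof.
have lft_span E : E \in span (@tensor_rel R M N) -> lft E = 0.
  move=> /asboolP[n [c [a [ra ->]]]]; rewrite linear_sum big1 // => i _.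
  rewrite linearZ /= -[RHS](scaler0 _ (c i)); congr (_ *: _).
  case: (ra i) => [x x' y|x y y'|b x y|b x y];
    rewrite !raddfB /= ?linearZ /= !free_liftE /=.
  - by rewrite linearD tensor_pureDl addrAC addrK subrr.
  - by rewrite tensor_pureDr addrAC addrK subrr.
  - by rewrite linearZ tensor_pureZl -scalerDr subrr scaler0.
  - by rewrite tensor_pureZr -scalerDr subrr scaler0.
apply/eqP; rewrite -subr_eq0 -raddfB; apply/eqP/lft_span.
exact/to_quot_eq/to_quotK.
Qed.

Fact tensor_map_linear : linear tensor_map.
Proof.
move=> a s t; rewrite -[s]to_quotK -[t]to_quotK -linearP.
by rewrite !tensor_map_quot linearP.
Qed.
HB.instance Definition _ := GRing.isLinear.Build R (tensor M N) (tensor M' N)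
  *:%R tensor_map tensor_map_linear.

Lemma tensor_mapE x y : tensor_map (tensor_pure x y) = tensor_pure (f x) y.
Proof. by rewrite tensor_map_quot /lft /= free_liftE. Qed.

End TensorMap.
Arguments tensor_map {R M M'} N f t.

Section Hom.
Variables (R : comNzRingType) (U V : lmodType R).

Definition hom_pred : {pred U -> V} := fun f => `[< linear f >].

Fact hom_submod_closed : submod_closed hom_pred.
Proof.
split=> [|k f g]; first by apply/asboolP => a u v /=; rewrite scaler0 addr0.
move=> /asboolP lf /asboolP lg; apply/asboolP => a u v.
rewrite /= !fctE lf lg !scalerDr !scalerA [k * a]mulrC.
by rewrite -!addrA; congr (_ + _); rewrite addrCA.
Qed.
HB.instance Definition _ := GRing.isSubmodClosed.Build R (U -> V) hom_pred
  (GRing.submod_closed_semi hom_submod_closed).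

Definition hom_mod : lmodType R := submod hom_pred.

End Hom.

Section HomMap.
Variables (R : comNzRingType) (U U' V : lmodType R) (f : {linear U -> U'}).

Fact hom_map_subproof (h : hom_mod U' V) : (val h \o f) \in @hom_pred R U V.
Proof.
apply/asboolP => a u v /=; rewrite linearP.
by have /asboolP -> := valP h.
Qed.

(* Hom(f, V), precomposition with f *)
Definition hom_map (h : hom_mod U' V) : hom_mod U V :=
  Submod (hom_map_subproof h).

Fact hom_map_linear : linear hom_map.
Proof. by move=> a g h; apply/val_inj. Qed.
HB.instance Definition _ := GRing.isLinear.Build R (hom_mod U' V) (hom_mod U V)
  *:%R hom_map hom_map_linear.

End HomMap.
Arguments hom_map {R U U'} V f h.

Section Resolutions.
Variable R : comNzRingType.
Implicit Types (M N P E : lmodType R).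

Definition surj (U V : lmodType R) (g : {linear U -> V}) : Prop := forall v, exists u, g u = v.

Definition projective P : Prop :=
  forall (U V : lmodType R) (g : {linear U -> V}) (f : {linear P -> V}),
    surj g -> exists h : {linear P -> U}, forall x, g (h x) = f x.

Definition injective_mod E : Prop :=
  forall (U V : lmodType R) (g : {linear U -> V}) (f : {linear U -> E}),
    injective g -> exists h : {linear V -> E}, forall u, h (g u) = f u.

Record proj_resolution M := ProjResolution {
  pr_obj :> nat -> lmodType R;
  pr_d : forall i, {linear pr_obj i.+1 -> pr_obj i};
  pr_aug : {linear pr_obj 0 -> M};
  pr_proj : forall i, projective (pr_obj i);
  pr_surj : surj pr_aug;
  pr_exact0 : exact_at (pr_d 0) pr_aug;
  pr_exact : forall i, exact_at (pr_d i.+1) (pr_d i)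
}.

Record inj_resolution M := InjResolution {
  ir_obj :> nat -> lmodType R;
  ir_d : forall i, {linear ir_obj i -> ir_obj i.+1};
  ir_aug : {linear M -> ir_obj 0};
  ir_inj : forall i, injective_mod (ir_obj i);
  ir_mono : injective ir_aug;
  ir_exact0 : exact_at ir_aug (ir_d 0);
  ir_exact : forall i, exact_at (ir_d i) (ir_d i.+1)
}.

Definition finite_inj_dim M : Prop :=
  exists (n : nat) (E : inj_resolution M),
    forall i, (n < i)%N -> forall x : E i, x = 0.

(* Tor_i(M, N) = H_i(P (x) N) and Ext^i(M, N) = H^i(Hom(P, N)), computed from a
   projective resolution P of M. The complexes are extended by the zero module
   'rV[R]_0. *)
Definition Tor M (P : proj_resolution M) N (i : nat) : lmodType R :=
  match i with
  | 0 => homology (tensor_map N (pr_d P 0))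
                  (\0 : {linear tensor (P 0) N -> 'rV[R]_0})
  | j.+1 => homology (tensor_map N (pr_d P j.+1)) (tensor_map N (pr_d P j))
  end.

Definition Ext M (P : proj_resolution M) N (i : nat) : lmodType R :=
  match i with
  | 0 => homology (\0 : {linear 'rV[R]_0 -> hom_mod (P 0) N})
                  (hom_map N (pr_d P 0))
  | j.+1 => homology (hom_map N (pr_d P j)) (hom_map N (pr_d P j.+1))
  end.

Lemma free_projective (X : choiceType) : projective {freeg X / R}.
Proof.
move=> U V g f g_surj; have /choice[s sP] : forall x, exists u, g u = f << x >>.
  by move=> x; apply: g_surj.
exists (free_lift s) => D.
pose gs : {linear {freeg X / R} -> V} := g \o free_lift s.
by apply: (@free_linear_ext R X V gs f) => x; rewrite /gs /= free_liftE sP.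
Qed.

Section FreeResolution.
Variable M : lmodType R.

Definition free_cover (V : lmodType R) : {linear {freeg V / R} -> V} :=
  free_lift (@id V).

Fixpoint free_syz (n : nat) : lmodType R :=
  if n is p.+1 then ker_mod (free_cover (free_syz p)) else M.

Definition free_obj n : lmodType R := {freeg (free_syz n) / R}.

Definition free_d n : {linear free_obj n.+1 -> free_obj n} :=
  free_lift (fun z : free_syz n.+1 => val z).

Lemma free_cover_surj V : surj (free_cover V).
Proof. by move=> v; exists << v >>; rewrite /free_cover /= free_liftE. Qed.

Lemma free_dE n D : free_d n D = val (free_cover (free_syz n.+1) D).
Proof.
pose h : {linear free_obj n.+1 -> free_obj n} :=
  val \o free_cover (free_syz n.+1).
apply: (@free_linear_ext _ _ _ (free_d n) h) => x.
by rewrite /h /free_d /= !free_liftE.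
Qed.

Lemma free_exact n : exact_at (free_d n) (free_cover (free_syz n)).
Proof.
move=> v; split=> [v0|[D <-]]; last first.
  by rewrite free_dE; apply/eqP/(valP (free_cover (free_syz n.+1) D)).
have kv : v \in ker_pred (free_cover (free_syz n)) by apply/eqP.
have [D DE] := free_cover_surj (Submod kv : free_syz n.+1).
by exists D; rewrite free_dE DE.
Qed.

Lemma free_exactS n : exact_at (free_d n.+1) (free_d n).
Proof.
move=> v; rewrite -(@free_exact n.+1 v) free_dE; split=> [v0|->]; last by rewrite raddf0.
by apply: val_inj; rewrite v0.
Qed.

Definition free_resolution : proj_resolution M :=
  @ProjResolution M free_obj free_d (free_cover M)
    (fun i => free_projective (X := free_syz i)) (@free_cover_surj M)
    (@free_exact 0) free_exactS.

End FreeResolution.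

End Resolutions.

Section Rings.
Variable R : comNzRingType.

(* Ideals of R are the submodules of the regular module R^o. *)

Definition noetherian : Prop := forall I : submodClosed R^o, fin_gen I.

Definition maximal_ideal (m : submodClosed R^o) : Prop :=
  1 \notin m /\
  forall J : submodClosed R^o, 1 \notin J -> {subset m <= J} -> J =i m.

Definition local_ring (m : submodClosed R^o) : Prop :=
  maximal_ideal m /\ forall J, maximal_ideal J -> J =i m.

(* Meant for Noetherian local rings; in general one would ask this of all
   localizations. *)
Definition gorenstein : Prop := finite_inj_dim R^o.

Variable m : submodClosed R^o.

(* b is a basis over R/m of the module V, where m V = 0; scalars in R/m are
   given by representatives in R. *)
Definition residue_basis (V : lmodType R) (n : nat) (b : 'I_n -> V) : Prop :=
  (forall v, exists c : 'I_n -> R, v = \sum_(i < n) c i *: b i) /\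
  (forall c : 'I_n -> R, \sum_(i < n) c i *: b i = 0 -> forall i, c i \in m).

(* rank of L/mL over R/m; the default value 0 is irrelevant when L is finitely
   generated. *)
Definition nu (L : lmodType R) : nat :=
  xget 0%N [set n | exists b : 'I_n -> quot_mod (prod_submod m (@predT L)),
                      residue_basis b].

Definition annihilated (L : lmodType R) : Prop :=
  forall a (x : L), a \in m -> a *: x = 0.

End Rings.

Definition fps_mul (f g : nat -> int) : nat -> int :=
  fun n => \sum_(i < n.+1) f i * g (n - i)%N.

Definition fps_of_poly (p : {poly int}) : nat -> int := fun n => p`_n.

Definition is_poly (f : nat -> int) : Prop :=
  exists p : {poly int}, f =1 fps_of_poly p.

(* Main.v *)
Require Import Defs.
From HB Require Import structures.
From mathcomp Require Import all_boot all_order all_algebra.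
From mathcomp Require Import all_classical zify ring.
From mathcomp.multinomials Require freeg.

(* Since R has finite injective dimension and m is nilpotent, R is injective
   over itself, its socle is m^2 = R s, and R has length e + 2.

   Let K = Ker (F -> X) be a minimal syzygy.  A quotient I of K with m^2 I = 0
   maps to F' = R^c, c = length (m I), so that m I is carried onto the socle of
   F'; extending K -> F' to F makes Y = F'/image(I) a quotient of X.  Counting
   lengths, if length (I/soc I) <= c then Y satisfies the same inequality and
   length (m Y) >= (e - 1) c >= 2 c.  Hence a high syzygy of M has no quotient
   I with m^2 I = 0, m I <> 0 and length (I/soc I) <= length (m I).  Dually, a
   high cosyzygy L has no submodule I with m^2 I = 0, I <> soc I and
   length (m I) <= length (I/soc I).

   Applied to I = R/m^2, the first fact gives m K = m^2 F for high syzygies, so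
   the Betti numbers satisfy b_n + b_(n+2) = e b_(n+1).  Applied to the image of
   a map from a high syzygy to a high cosyzygy, the two facts contradict each
   other unless the map kills the radical of its source; shifting dimensions,
   Ext^i (M, N) is then killed by m and its length is a fixed linear
   combination of two consecutive Betti numbers.  Tor follows by duality from
   Hom (Tor_i (M, N), R) = Ext^i (M, Hom (N, R)). *)

Set Implicit Arguments.
Unset Strict Implicit.
Unset Printing Implicit Defensive.

Import GRing.Theory.
Local Open Scope ring_scope.
(* [vector] exports another [span]. *)
Local Notation span := Defs.span.

(** * Linear maps and submodules *)

Section LinearAlgebra.
Variable R : comNzRingType.
Implicit Types U V W K L Q X E : lmodType R.

(** The factor e - 1 arises as follows: m F' has length (e + 1) c, and the image of I takes at most
    2 c of it, namely c for the socle and c for the part coming from I/soc I. For e = 2 the factor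
    would be 1 and nothing would grow; for e > 2 the bound doubles at each step and passes the
    length of M, or of N, after finitely many steps.

    The two kinds of width are opposite inequalities between length (I/soc I) and length (m I), so
    every I with m I <> 0 falls under one of them. Both arguments of Ext must therefore be moved: a
    degree is split as n + j + 1, with j cosyzygies of N fixed once and for all and n syzygies of M
    growing.

    Two obstacles shape the rest. Intermediate modules such as Y are not killed by m, so lengths are
    counted instead of ranks over R/m, and [nu] is identified with length only at the end. The given
    projective resolution need be neither minimal nor of finite rank, so its syzygies are compared
    with minimal ones in the stable category. *)

Lemma linear_exists U V (f : U -> V) : linear f ->
  exists g : {linear U -> V}, forall u, g u = f u.
Proof.
move=> lf; pose h := GRing.isLinear.Build R U V *:%R f lf.
pose H : {linear U -> V} := HB.pack f h.
by exists H.
Qed.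

Lemma linear_zero U V : exists g : {linear U -> V}, forall u, g u = 0.
Proof. by apply: linear_exists => a x y; rewrite scaler0 addr0. Qed.

Definition surjf U V (f : U -> V) := forall v, exists u, f u = v.

Definition injf U V (f : U -> V) := forall u, f u = 0 -> u = 0.

Lemma injfP U V (f : {linear U -> V}) : injf f -> injective f.
Proof.
by move=> f0 u v fuv; apply/eqP; rewrite -subr_eq0; apply/eqP/f0; rewrite linearB fuv subrr.
Qed.

Lemma injfI U V (f : {linear U -> V}) : injective f -> injf f.
Proof. by move=> fi u fu; apply: fi; rewrite fu linear0. Qed.

Lemma linear_lift_surj V Q W (p : {linear V -> Q}) (f : {linear V -> W}) :
  surjf p -> (forall v, p v = 0 -> f v = 0) ->
  exists g : {linear Q -> W}, forall v, g (p v) = f v.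
Proof.
move=> ps pf; have /choice[s sP] := ps.
have fs v : f (s (p v)) = f v.
  apply/eqP; rewrite -subr_eq0 -linearB; apply/eqP/pf.
  by rewrite linearB sP subrr.
have lg : linear (f \o s).
  move=> a x y /=; rewrite -linearP -[in RHS]fs; congr (f (s _)).
  by rewrite linearP !sP.
have [g gE] := linear_exists lg.
by exists g => v; rewrite gE /= fs.
Qed.

Lemma linear_lift_inj V K W (i : {linear K -> W}) (f : {linear V -> W}) :
  injf i -> (forall v, exists k, i k = f v) ->
  exists g : {linear V -> K}, forall v, i (g v) = f v.
Proof.
move=> ii /choice[s sP].
have ls : linear s.
  by move=> a x y; apply: (injfP ii); rewrite linearP !sP linearP.
have [g gE] := linear_exists ls.
by exists g => v; rewrite gE sP.
Qed.

(** Submodules are kept as [Prop]-valued predicates, so that images, preimages, kernels and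
    intersections need no packed structure; [mem_span_sub] links them to [span]. *)
Definition issub V (S : V -> Prop) :=
  S 0 /\ forall a u v, S u -> S v -> S (a *: u + v).

Section IsSub.
Variables (V : lmodType R) (S : V -> Prop).
Hypothesis sS : issub S.

Lemma issub0 : S 0. Proof. by case: sS. Qed.

Lemma issubD u v : S u -> S v -> S (u + v).
Proof. by move=> Su Sv; rewrite -[u]scale1r; apply: sS.2. Qed.

Lemma issubZ a u : S u -> S (a *: u).
Proof. by move=> Su; rewrite -[_ *: _]addr0; apply: sS.2 => //; apply: issub0. Qed.

Lemma issubN u : S u -> S (- u).
Proof. by rewrite -scaleN1r; apply: issubZ. Qed.

Lemma issubB u v : S u -> S v -> S (u - v).
Proof. by move=> Su Sv; apply: issubD => //; apply: issubN. Qed.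

Lemma issub_sum n (f : 'I_n -> V) : (forall i, S (f i)) -> S (\sum_i f i).
Proof. by move=> Sf; apply: big_ind => [|u v|i _]; [apply: issub0|apply: issubD|]. Qed.

Lemma mem_span_sub u : u \in span S <-> S u.
Proof.
split=> [/asboolP[n [c [a [Sa ->]]]]|]; last exact: span_gen.
by apply: issub_sum => i; apply: issubZ.
Qed.

End IsSub.

Lemma span_min V (A S : V -> Prop) : issub S -> (forall v, A v -> S v) ->
  forall v, v \in span A -> S v.
Proof.
move=> sS AS v /asboolP[n [c [a [Aa ->]]]].
by apply: issub_sum => // i; apply: issubZ => //; apply: AS.
Qed.

Lemma issub_closed V (S : submodClosed V) : issub (fun v => v \in S).
Proof. by split=> [|a u v Su Sv]; rewrite ?rpred0 // rpredD // rpredZ. Qed.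

Lemma quot_exists V (S : V -> Prop) : issub S ->
  exists Q (p : {linear V -> Q}), surjf p /\ forall v, p v = 0 <-> S v.
Proof.
move=> sS; exists (quot_mod (span S)), (to_quot (span S)); split=> [q|v].
  by exists (quot_repr q); apply: to_quotK.
rewrite -(mem_span_sub sS) -[X in _ <-> X \in _]subr0.
by rewrite -(linear0 (to_quot (span S))); apply: to_quot_eq.
Qed.

Lemma sub_exists V (S : V -> Prop) : issub S ->
  exists K (i : {linear K -> V}), injf i /\ forall v, S v <-> exists k, i k = v.
Proof.
move=> sS; exists (submod (span S)), (val : {linear submod (span S) -> V}); split.
  by move=> u u0; apply: val_inj; rewrite u0.
move=> v; split=> [Sv|[k <-]]; last exact/(mem_span_sub sS)/(valP k).
have Sv' : v \in span S by apply/(mem_span_sub sS).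
by exists (Submod Sv').
Qed.

Definition imsub U V (f : U -> V) (S : U -> Prop) : V -> Prop :=
  fun v => exists u, S u /\ f u = v.

Definition kersub U V (f : U -> V) (S : U -> Prop) : U -> Prop :=
  fun u => S u /\ f u = 0.

Definition full V : V -> Prop := fun _ => True.

Definition capsub V (S T : V -> Prop) : V -> Prop := fun v => S v /\ T v.

Lemma issub_im U V (f : {linear U -> V}) S : issub S -> issub (imsub f S).
Proof.
move=> sS; split=> [|a _ _ [u [Su <-]] [v [Sv <-]]].
  by exists 0; rewrite linear0; split=> //; apply: issub0.
by exists (a *: u + v); rewrite linearP; split=> //; apply: sS.2.
Qed.

Lemma issub_pre U V (f : {linear U -> V}) S : issub S -> issub (fun u => S (f u)).
Proof.
move=> sS; split=> [|a u v Su Sv]; rewrite ?linear0 ?linearP; first exact: issub0.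
exact: sS.2.
Qed.

Lemma issub_cap V (S T : V -> Prop) : issub S -> issub T -> issub (capsub S T).
Proof.
move=> sS sT; split=> [|a u v [Su Tu] [Sv Tv]]; first by split; apply: issub0.
by split; [apply: sS.2|apply: sT.2].
Qed.

Lemma issub_ker U V (f : {linear U -> V}) S : issub S -> issub (kersub f S).
Proof.
move=> sS; split=> [|a u v [Su fu] [Sv fv]]; first by rewrite /kersub linear0; split=> //; apply: issub0.
by rewrite /kersub linearP fu fv scaler0 addr0; split=> //; apply: sS.2.
Qed.

Lemma issub_full V : issub (@full V). Proof. by []. Qed.

Lemma issub_zero V : issub (fun v : V => v = 0).
Proof. by split=> // a u v -> ->; rewrite scaler0 addr0. Qed.

Lemma issub_principal (s : R) : issub (fun x : R^o => exists r : R, x = r * s).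
Proof.
split=> [|a _ _ [r ->] [t ->]]; first by exists 0; rewrite mul0r.
by exists (a * r + t); rewrite mulrDl -mulrA.
Qed.

Definition comb n V (x : 'I_n -> V) (w : 'rV[R]_n) : V := \sum_i w 0 i *: x i.

Lemma comb_is_linear n V (x : 'I_n -> V) : linear (comb x).
Proof.
move=> a u v; rewrite /comb scaler_sumr -big_split /=; apply: eq_bigr => i _.
by rewrite !mxE scalerDl scalerA.
Qed.

HB.instance Definition _ n V (x : 'I_n -> V) :=
  GRing.isLinear.Build R 'rV[R]_n V *:%R (comb x) (comb_is_linear x).

Lemma comb_delta n V (x : 'I_n -> V) i : comb x (delta_mx 0 i) = x i.
Proof.
rewrite /comb (bigD1 i) //= big1 ?addr0 => [|j ji]; first by rewrite mxE !eqxx scale1r.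
by rewrite mxE eqxx (negPf ji) scale0r.
Qed.

Lemma linear_combE n V (f : {linear 'rV[R]_n -> V}) w :
  f w = comb (fun i => f (delta_mx 0 i)) w.
Proof. by rewrite {1}[w]row_sum_delta linear_sum; apply: eq_bigr => i _; rewrite linearZ. Qed.

Lemma linear_comb n V W (f : {linear V -> W}) (x : 'I_n -> V) w :
  f (comb x w) = comb (fun i => f (x i)) w.
Proof. by rewrite /comb linear_sum; apply: eq_bigr => i _; rewrite linearZ. Qed.

Lemma comb_sub n V (S : V -> Prop) (x : 'I_n -> V) w :
  issub S -> (forall i, S (x i)) -> S (comb x w).
Proof. by move=> sS Sx; apply: issub_sum => // i; apply: issubZ. Qed.

Lemma rV_projective n : projective 'rV[R]_n.
Proof.
move=> U V g f gs; have /choice[s sP] : forall i, exists u, g u = f (delta_mx 0 i).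
  by move=> i; apply: gs.
exists (comb s) => w; rewrite linear_comb (linear_combE f).
by apply: eq_bigr => i _; rewrite sP.
Qed.

(** Both maps factor through U modulo the kernel of [h], where [h] becomes injective. *)
Lemma injective_ext E U V (h : {linear U -> V}) (f : {linear U -> E}) :
  injective_mod E -> (forall u, h u = 0 -> f u = 0) ->
  exists g : {linear V -> E}, forall u, g (h u) = f u.
Proof.
move=> injE hf; have [Q [p [ps pk]]] := quot_exists (issub_ker h (@issub_full U)).
have [h' h'E] := linear_lift_surj (f := h) ps (fun v pv => ((pk v).1 pv).2).
have [f' f'E] := linear_lift_surj (f := f) ps (fun v pv => hf v ((pk v).1 pv).2).
have h'i : injective h'.
  apply: injfP => q; have [v <-] := ps q; rewrite h'E => hv.
  by apply/pk; split.
have [g gE] := injE _ _ h' f' h'i.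
by exists g => u; rewrite -h'E gE f'E.
Qed.

Lemma rV_injective n : injective_mod (R^o : lmodType R) -> injective_mod 'rV[R]_n.
Proof.
move=> injR U V g f gi.
have /choice[s sP] : forall j, exists h : {linear V -> R^o}, forall u, h (g u) = f u 0 j.
  move=> j; have lf : linear (fun u => f u 0 j : R^o) by move=> a u v; rewrite linearP !mxE.
  have [fj fjE] := linear_exists lf.
  by have [h hE] := injR _ _ g fj gi; exists h => u; rewrite hE fjE.
have lh : linear (fun v => \row_j (s j v : R)).
  by move=> a u v; apply/rowP => j; rewrite !mxE linearP.
have [h hE] := linear_exists lh.
by exists h => u; apply/rowP => j; rewrite hE mxE sP.
Qed.

Definition iso_mod U V := exists f : {linear U -> V}, injf f /\ surjf f.

Lemma iso_trans U V W : iso_mod U V -> iso_mod V W -> iso_mod U W.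
Proof.
move=> [f [fi fs]] [g [gi gs]]; exists (g \o f); split=> [u /gi/fi//|w].
by have [v <-] := gs w; have [u <-] := fs v; exists u.
Qed.

Lemma iso_sym U V : iso_mod U V -> iso_mod V U.
Proof.
move=> [f [fi fs]].
have [g gE] := linear_lift_surj (f := idfun : {linear U -> U}) fs fi.
exists g; split=> [v|u]; last by exists (f u); rewrite gE.
by have [u <-] := fs v; rewrite gE /= => ->; rewrite linear0.
Qed.

Definition quot_of V (S : V -> Prop) Q (p : V -> Q) :=
  surjf p /\ forall v, p v = 0 <-> S v.

(* A linear correspondence between V and V' that is total on both sides and
   matches S with S' induces V/S ~ V'/S'. *)
Lemma quot_rel_iso V V' (S : V -> Prop) (S' : V' -> Prop) Q Q'
    (p : {linear V -> Q}) (p' : {linear V' -> Q'}) (r : V -> V' -> Prop) :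
  quot_of S p -> quot_of S' p' ->
  (forall a u v u' v', r u u' -> r v v' -> r (a *: u + v) (a *: u' + v')) ->
  (forall u, exists u', r u u') -> (forall u', exists u, r u u') ->
  (forall u u', r u u' -> S u <-> S' u') -> iso_mod Q Q'.
Proof.
move=> [ps pk] [ps' pk'] rl rt rs rS.
have /choice[f fP] : forall q, exists q', exists u u', [/\ p u = q, p' u' = q' & r u u'].
  by move=> q; have [u <-] := ps q; have [u' ?] := rt u; exists (p' u'), u, u'.
have rB u v u' v' : r u u' -> r v v' -> r (u - v) (u' - v').
  move=> ru rv; rewrite -[u - v]addrC -[u' - v']addrC -!scaleN1r; exact: rl.
have fE u u' : r u u' -> f (p u) = p' u'.
  move=> ru; have [v [v' [pv <- rv]]] := fP (p u).
  apply/eqP; rewrite -subr_eq0 -linearB; apply/eqP/pk'/(rS _ _ (rB _ _ _ _ rv ru))/pk.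
  by rewrite linearB pv subrr.
have lf : linear f.
  move=> a x y; have [u [u' [<- <- ru]]] := fP x; have [v [v' [<- <- rv]]] := fP y.
  by rewrite -!linearP; apply: fE; apply: rl.
have [g gE] := linear_exists lf; exists g; split.
  move=> q; have [u <-] := ps q; have [u' ru] := rt u; rewrite gE (fE _ _ ru).
  by move=> /pk' /(rS _ _ ru) /pk.
move=> q'; have [u' <-] := ps' q'; have [u ru] := rs u'.
by exists (p u); rewrite gE (fE _ _ ru).
Qed.

End LinearAlgebra.

Arguments full {R V} _.

(** * Length *)

Section Length.
Variable R : comNzRingType.
Implicit Types U V W : lmodType R.

(* S is the top of a chain of n strict inclusions of submodules. *)
Fixpoint lge V n (S : V -> Prop) : Prop :=
  if n is p.+1 then
    exists T : V -> Prop, [/\ issub T, forall v, T v -> S v,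
      exists v, S v /\ ~ T v & lge p T]
  else True.

Lemma lge_mono V n (S S' : V -> Prop) :
  (forall v, S v -> S' v) -> lge n S -> lge n S'.
Proof.
case: n => // n SS' [T [sT TS [v [Sv Tv]] lT]]; exists T; split=> //.
  by move=> u /TS/SS'.
by exists v; split=> //; apply: SS'.
Qed.

Lemma lgeW V n (S : V -> Prop) : lge n.+1 S -> lge n S.
Proof.
elim: n S => // n IHn S [T [sT TS ex lT]]; exists T; split=> //.
exact: IHn.
Qed.

Lemma lge_leq V n k (S : V -> Prop) : (k <= n)%N -> lge n S -> lge k S.
Proof.
move=> /subnK<-; elim: (n - k)%N => // d IHd; rewrite addSn => /lgeW; exact: IHd.
Qed.

Definition finlen V (S : V -> Prop) := exists n, ~ lge n S.

(* The value 0 is junk when S has infinite length. *)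
Definition len V (S : V -> Prop) : nat := xget 0%N [set n | lge n S /\ ~ lge n.+1 S]%classic.

Lemma lenP V (S : V -> Prop) : finlen S -> lge (len S) S /\ ~ lge (len S).+1 S.
Proof.
move=> [n nS]; have /(xgetPex 0%N) // : exists n, lge n S /\ ~ lge n.+1 S.
elim: n nS => [[]//|n IHn nS].
by have [lS|/IHn//] := pselect (lge n S); exists n.
Qed.

Lemma lgeE V n (S : V -> Prop) : finlen S -> lge n S <-> (n <= len S)%N.
Proof.
move=> /lenP[l1 l2]; split=> [ln|nl]; last exact: lge_leq l1.
by rewrite leqNgt; apply/negP => /lge_leq/(_ ln).
Qed.

Lemma len_unique V n (S : V -> Prop) : lge n S -> ~ lge n.+1 S -> finlen S /\ len S = n.
Proof.
move=> l1 l2; have fS : finlen S by exists n.+1.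
split=> //; apply/eqP; rewrite eqn_leq; apply/andP; split; last exact/lgeE.
by rewrite leqNgt; apply/negP => /(lgeE _ fS).
Qed.

Lemma len_le V W (S : V -> Prop) (T : W -> Prop) :
  (forall n, lge n S -> lge n T) -> finlen T -> finlen S /\ (len S <= len T)%N.
Proof.
move=> ST fT; have fS : finlen S by have [n nT] := fT; exists n => /ST.
by split=> //; apply/lgeE => //; apply/ST/lgeE.
Qed.

Lemma len_sub V (S T : V -> Prop) : (forall v, S v -> T v) -> finlen T ->
  finlen S /\ (len S <= len T)%N.
Proof. by move=> ST; apply: len_le => n; apply: lge_mono. Qed.

Lemma len_ext V (S T : V -> Prop) : (forall v, S v <-> T v) -> len S = len T.
Proof.
move=> ST; congr (len _); apply/funext => v; apply/propext; exact: ST.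
Qed.

Lemma finlen_ext V (S T : V -> Prop) : (forall v, S v <-> T v) -> finlen S -> finlen T.
Proof. by move=> ST /(len_sub (fun v => (ST v).2))[]. Qed.

Lemma len_sub_eq V (S T : V -> Prop) : issub S -> (forall v, S v -> T v) -> finlen T ->
  (len T <= len S)%N -> forall v, T v -> S v.
Proof.
move=> sS ST fT lTS v Tv; apply: contrapT => Sv.
have [fS _] := len_sub ST fT.
have : lge (len S).+1 T by exists S; split=> //; [exists v|apply/lgeE].
by move/(lgeE _ fT); rewrite ltnNge lTS.
Qed.

(** A strict inclusion of T in S stays strict in the kernel or in the image: if [f v = f u] with [u]
    in T and [v] outside T, then [v - u] is a kernel element outside T. Each step of the chain is
    charged to one of the two sides. *)
Lemma lge_split U V (f : {linear U -> V}) n (S : U -> Prop) : issub S -> lge n S ->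
  exists a b, [/\ a + b = n, lge a (kersub f S) & lge b (imsub f S)]%N.
Proof.
elim: n S => [|n IHn] S sS; first by exists 0%N, 0%N.
move=> [T [sT TS [v [Sv Tv]] lT]]; have [a [b [abn la lb]]] := IHn T sT lT.
have [[w [Sw fw Tw]]|noker] := pselect (exists w, [/\ S w, f w = 0 & ~ T w]).
  exists a.+1, b; split; first by rewrite addSn abn.
    exists (kersub f T); split=> //; first exact: issub_ker.
    - by move=> u [/TS].
    - by exists w; split=> // -[].
  by apply: lge_mono lb => _ [u [/TS Su <-]]; exists u.
exists a, b.+1; split; first by rewrite addnS abn.
  by apply: lge_mono la => u [/TS].
exists (imsub f T); split=> //; first exact: issub_im.
- by move=> _ [u [/TS Su <-]]; exists u.
- exists (f v); split; first by exists v.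
  move=> [u [Tu fuv]]; apply: Tv.
  have -> : v = (v - u) + u by rewrite subrK.
  apply: issubD => //; apply: contrapT => Tvu; apply: noker; exists (v - u).
  by split=> //; [apply: issubB => //; apply: TS|rewrite linearB fuv subrr].
Qed.

(** The preimage of a chain in the image is stacked on top of a chain in the kernel. *)
Lemma lge_join U V (f : {linear U -> V}) a b (S : U -> Prop) : issub S ->
  lge a (kersub f S) -> lge b (imsub f S) -> lge (a + b) S.
Proof.
move=> sS la; elim: b S sS la => [|b IHb] S sS la.
  by rewrite addn0 => _; apply: lge_mono la => u [].
rewrite addnS => -[T [sT TS [_ [[v [Sv <-]] Tv]] lT]].
pose S' := fun u => S u /\ T (f u).
have sS' : issub S' by apply: issub_cap => //; apply: issub_pre.
exists S'; split=> //; first by move=> u [].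
  by exists v; split=> // -[].
apply: IHb => //.
  by apply: lge_mono la => u [Su fu]; split=> //; split=> //; rewrite fu; apply: issub0.
by apply: lge_mono lT => w Tw; have [u [Su fu]] := TS w Tw; exists u; rewrite /S' fu.
Qed.

Lemma len_add U V (f : {linear U -> V}) (S : U -> Prop) : issub S ->
  finlen (kersub f S) -> finlen (imsub f S) ->
  finlen S /\ len S = (len (kersub f S) + len (imsub f S))%N.
Proof.
move=> sS fk fi; apply: len_unique.
  by apply: lge_join => //; apply/lgeE => //.
move=> /(lge_split f sS)[a [b [abE /(lgeE _ fk) la /(lgeE _ fi) lb]]].
by have := leq_add la lb; rewrite abE ltnn.
Qed.

Lemma finlen_ker U V (f : {linear U -> V}) (S : U -> Prop) :
  finlen S -> finlen (kersub f S).
Proof. by move=> fS; have [] := len_sub (S := kersub f S) _ fS => // u []. Qed.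

Lemma finlen_im U V (f : {linear U -> V}) (S : U -> Prop) : issub S ->
  finlen S -> finlen (imsub f S).
Proof.
move=> sS fS; have [|//] := @len_le V U (imsub f S) S _ fS.
by move=> n ln; apply: (@lge_join _ _ f 0%N n).
Qed.

Lemma lenD U V (f : {linear U -> V}) (S : U -> Prop) : issub S -> finlen S ->
  len S = (len (kersub f S) + len (imsub f S))%N.
Proof.
by move=> sS fS; have [] := len_add sS (finlen_ker f fS) (finlen_im f sS fS).
Qed.

Lemma len0 V (S : V -> Prop) : (forall v, S v -> v = 0) -> finlen S /\ len S = 0%N.
Proof.
move=> S0; apply: len_unique => //= -[T [sT TS [v [/S0 -> /(_ (issub0 sT))]]]] //.
Qed.

Lemma len_eq0 V (S : V -> Prop) : issub S -> finlen S -> len S = 0%N -> forall v, S v -> v = 0.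
Proof.
move=> sS fS l0 v Sv; apply: contrapT => v0.
suff: lge 1 S by move/(lgeE _ fS); rewrite l0.
exists (fun v => v = 0); split=> //; first exact: issub_zero.
- by move=> _ ->; apply: issub0.
- by exists v.
Qed.

Lemma len_imsub_inj U V (f : {linear U -> V}) (S : U -> Prop) : issub S -> finlen S ->
  (forall u, S u -> f u = 0 -> u = 0) -> len (imsub f S) = len S.
Proof.
move=> sS fS fi; rewrite (lenD f sS fS).
by have [u [Su /(fi _ Su)]//|_ ->] := @len0 _ (kersub f S).
Qed.

Lemma finlen_inj U V (f : {linear U -> V}) (S : U -> Prop) : issub S ->
  (forall u, S u -> f u = 0 -> u = 0) -> finlen (imsub f S) -> finlen S.
Proof.
move=> sS fi fim; have [u [Su /(fi _ Su)]//|fk _] := @len0 _ (kersub f S).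
by have [] := len_add sS fk fim.
Qed.

Lemma iso_len U V : iso_mod U V -> finlen (@full _ U) ->
  finlen (@full _ V) /\ len (@full _ V) = len (@full _ U).
Proof.
move=> [f [fi fs]] fU; have sU : issub (@full _ U) by [].
have e : forall v, imsub f (@full _ U) v <-> full v.
  by move=> v; split=> // _; have [u <-] := fs v; exists u.
split; first exact: finlen_ext e (finlen_im f sU fU).
rewrite -(len_ext e) len_imsub_inj // => u _; exact: fi.
Qed.

(* If the linear maps g i : V -> W identify S with the b-fold power of T, then
   len S = b * len T. *)
Lemma len_power V W b (g : 'I_b -> {linear V -> W}) (S : V -> Prop) (T : W -> Prop) :
  issub S -> issub T -> finlen T ->
  (forall v, S v -> forall i, T (g i v)) ->
  (forall t : 'I_b -> W, (forall i, T (t i)) -> exists v, S v /\ forall i, g i v = t i) ->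
  (forall v, S v -> (forall i, g i v = 0) -> v = 0) ->
  finlen S /\ len S = (b * len T)%N.
Proof.
move=> sS sT fT gT gs gi.
(* Filtration by the vanishing of the first [k] coordinates; each successive quotient is a copy of
   [T]. *)
pose Sk k v := S v /\ forall i : 'I_b, (i < k)%N -> g i v = 0.
have sSk k : issub (Sk k).
  split=> [|a u v [Su gu] [Sv gv]]; first by split=> [|i _]; rewrite ?linear0 //; apply: issub0.
  by split=> [|i ik]; [apply: sS.2|rewrite linearP gu // gv // scaler0 addr0].
suff H d : (d <= b)%N -> finlen (Sk (b - d)%N) /\ len (Sk (b - d)%N) = (d * len T)%N.
  have [f l] := H b (leqnn b); have e : forall v, Sk (b - b)%N v <-> S v.
    by move=> v; rewrite subnn; split=> [[]|].
  by split; [apply: finlen_ext f|rewrite -(len_ext e)].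
elim: d => [_|d IHd db].
  by rewrite subn0 mul0n; apply: len0 => v [Sv gv]; apply: gi => // i; apply: gv.
have kb : (b - d.+1 < b)%N by rewrite ltn_subLR // addSn ltnS leq_addl.
pose i0 := Ordinal kb.
have kE v : kersub (g i0) (Sk (b - d.+1)%N) v <-> Sk (b - d)%N v.
  rewrite -[(b - d)%N](@subnSK d b) //; split=> [[[Sv gv] gv0]|[Sv gv]].
    split=> // i; rewrite ltnS leq_eqVlt => /orP[/eqP ii0|]; last exact: gv.
    by rewrite (_ : i = i0) //; apply: val_inj.
  by split; [split=> // i ik; apply: gv; apply: ltnW|apply: gv => /=].
have iE w : imsub (g i0) (Sk (b - d.+1)%N) w <-> T w.
  split=> [[v [[Sv _] <-]]|Tw]; first exact: gT.
  have [|v [Sv gv]] := gs (fun i => if i == i0 then w else 0).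
    by move=> i; case: eqP => // _; apply: issub0.
  exists v; rewrite gv eqxx; split=> //; split=> // i ik; rewrite gv ifN //.
  by apply: contraTneq ik => ->; rewrite ltnn.
have [fk lk] := IHd (ltnW db).
have [||fS ->] := len_add (f := g i0) (sSk (b - d.+1)%N).
- by apply: finlen_ext fk => v; rewrite kE.
- by apply: finlen_ext fT => v; rewrite iE.
by split=> //; rewrite (len_ext kE) (len_ext iE) lk mulSn addnC.
Qed.

End Length.

(** * Injective modules and the Gorenstein hypothesis *)

Section Injectivity.
Variables (R : comNzRingType) (m : submodClosed R^o).
Implicit Types U V W C : lmodType R.

Hypothesis m_unit : forall u : R, u \notin m -> exists v : R, v * u = 1.
Hypothesis m3 : forall a b c : R, a \in m -> b \in m -> c \in m -> a * b * c = 0.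

(** If [v] itself does not work, some [a v] with a in m is outside [A], and then possibly some
    [b a v]; the search stops there because m^3 = 0. With A = 0 it says that every nonzero vector
    has a nonzero multiple in the socle. *)
Lemma essential_multiple V (A : V -> Prop) v : issub A -> ~ A v ->
  exists r : R, ~ A (r *: v) /\ forall a : R, a \in m -> A (a *: (r *: v)).
Proof.
move=> sA Av; have [h0|/existsNP[a /not_implyP[am Aav]]] := pselect (forall a : R, a \in m -> A (a *: v)).
  by exists 1; rewrite scale1r.
have [h1|/existsNP[b /not_implyP[bm Abav]]] := pselect (forall b : R, b \in m -> A (b *: (a *: v))).
  by exists a.
exists (b * a); rewrite -scalerA; split=> // c cm.
by rewrite !scalerA m3 // scale0r; apply: issub0.
Qed.

Section Baer.
Variable C : lmodType R.
Hypothesis ext_m : forall h : {linear submod m -> C}, exists z : C,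
  forall a : submod m, h a = (val a : R) *: z.

Variables (U V : lmodType R) (g : {linear U -> V}) (f : {linear U -> C}).
Hypothesis g_inj : injective g.

(* [Zorn_bigcup] also takes the union of the empty chain, hence the premise. *)
Definition partial_ext (G : set (V * C)%type) :=
  (exists p, G p) ->
  [/\ issub (G : (V * C)%type -> Prop), forall c, G (0, c) -> c = 0
    & forall u, G (g u, f u)].

Lemma partial_ext_functional G v c d : partial_ext G -> G (v, c) -> G (v, d) -> c = d.
Proof.
move=> pG Gc Gd; have [|sG G0 _] := pG; first by exists (v, c).
have := issubB sG Gc Gd; rewrite (_ : (v, c) - (v, d) = (0, c - d)).
  by move=> /G0/eqP; rewrite subr_eq0 => /eqP.
by congr (_, _); rewrite /= subrr.
Qed.

Lemma partial_ext_graph : partial_ext (fun p => exists u, p = (g u, f u)).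
Proof.
move=> _; split; last by move=> u; exists u.
  split=> [|a _ _ [u ->] [v ->]]; first by exists 0; rewrite !linear0.
  by exists (a *: u + v); rewrite !linearP.
by move=> c [u [gu ->]]; rewrite (_ : u = 0) ?linear0 //; apply: g_inj; rewrite linear0.
Qed.

Lemma partial_ext_bigcup (F : set (set (V * C)%type)) :
  (F `<=` partial_ext)%classic -> total_on F subset -> partial_ext (\bigcup_(X in F) X)%classic.
Proof.
move=> FP totF [p [X0 FX0 X0p]].
have [|sX0 _ gX0] := FP X0 FX0; first by exists p.
split.
- split; first by exists X0 => //; apply: issub0.
  move=> a u v [X FX Xu] [Y FY Yv]; have [XY|YX] := totF X Y FX FY.
    have [|sY _ _] := FP Y FY; first by exists v.
    by exists Y => //; apply: sY.2 => //; apply: XY.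
  have [|sX _ _] := FP X FX; first by exists u.
  by exists X => //; apply: sX.2 => //; apply: YX.
- move=> c [X FX Xc]; have [|_ X0' _] := FP X FX; first by exists (0, c).
  exact: X0'.
- by move=> u; exists X0.
Qed.

(** The values of [A] on the multiples [a w] with a in m define a linear map on m, hence
    multiplication by some [z], which becomes the value at [w]. A conflict x + r w = 0 has either r
    in m, where [z] agrees with [A], or r a unit, which would put [w] in the domain. *)
Lemma partial_ext_step A w : partial_ext A -> (exists p, A p) ->
  (forall c, ~ A (w, c)) ->
  (forall a : R, a \in m -> exists c, A (a *: w, c)) ->
  exists B, (A `<` B)%classic /\ partial_ext B.
Proof.
move=> pA Ane Aw mw; have [sA A0 gA] := pA Ane.
have /choice[h0 h0P] : forall a : submod m, exists c, A ((val a : R) *: w, c).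
  by move=> a; apply/mw/valP.
have lh : linear h0.
  move=> a x y; apply: (partial_ext_functional pA (h0P _)).
  have := sA.2 a _ _ (h0P x) (h0P y); congr A; congr (_, _) => /=.
  by rewrite scalerA -scalerDl.
have [h hE] := linear_exists lh; have [z zP] := ext_m h.
pose B : set (V * C)%type :=
  fun p => exists x r, A x /\ p = x + r *: (w, z).
exists B; split.
  split=> [p Ap|/(_ (w, z)) BA]; first by exists p, 0; rewrite scale0r addr0.
  apply: (Aw z); apply: BA; exists 0, 1; rewrite scale1r add0r; split=> //.
  exact: issub0.
move=> _; split.
- split; first by exists 0, 0; rewrite scale0r addr0; split=> //; apply: issub0.
  move=> a _ _ [x [r [Ax ->]]] [y [s [Ay ->]]]; exists (a *: x + y), (a * r + s).
  by split; [apply: sA.2|rewrite scalerDl scalerDr addrACA scalerA].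
- move=> c [[x d] [r [Ax /= [/esym/eqP xr cd]]]].
  move: cd xr; rewrite -/(@GRing.scale R C r z) -/(@GRing.scale R V r w) /= => cd.
  rewrite addr_eq0 => /eqP xr.
  have [rm|/m_unit[s sr]] := boolP (r \in m).
    have /= Arw := h0P (Submod rm); rewrite -hE zP /= in Arw.
    have := issubD sA Ax Arw; rewrite (_ : _ + _ = (0, c)) => [/A0//|].
    by rewrite cd; congr (_, _); rewrite /= xr addNr.
  case: (Aw (s *: - d)); have := issubZ sA s (issubN sA Ax); congr A; congr (_, _) => /=.
  by rewrite xr opprK scalerA sr scale1r.
- by move=> u; exists (g u, f u), 0; rewrite scale0r addr0.
Qed.

Lemma baer_ext : exists h : {linear V -> C}, forall u, h (g u) = f u.
Proof.
have [A [pA maxA]] := Zorn_bigcup partial_ext_bigcup.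
(* The empty graph satisfies [partial_ext] vacuously, so a maximal element has to be shown
   nonempty. *)
have Ane : exists p, A p.
  apply: contrapT => nA; suff /maxA : (A `<` (fun p => exists u, p = (g u, f u)))%classic.
    by apply; apply: partial_ext_graph.
  split=> [p Ap|/(_ (0, 0)) A0]; first by case: nA; exists p.
  by case: nA; exists (0, 0); apply: A0; exists 0; rewrite !linear0.
have [sA A0 gA] := pA Ane.
pose D v := exists c, A (v, c).
have sD : issub D.
  split=> [|a u v [c Ac] [d Ad]]; first by exists 0; exact: (issub0 sA).
  by exists (a *: c + d); exact: (sA.2 a _ _ Ac Ad).
have /choice[h0 h0P] : forall v, D v.
  move=> v; apply: contrapT => /(essential_multiple sD)[r [Dr mr]].
  have [|B [AB /maxA]] := partial_ext_step pA Ane (w := r *: v) _ mr; last by apply.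
  by move=> c Ac; apply: Dr; exists c.
have lh : linear h0.
  move=> a x y; apply: (partial_ext_functional pA (h0P _)).
  exact: (sA.2 a _ _ (h0P x) (h0P y)).
have [h hE] := linear_exists lh; exists h => u.
by rewrite hE; apply: (partial_ext_functional pA (h0P _)).
Qed.

End Baer.

(** Baer's criterion for the single ideal m: by [essential_multiple], a proper domain can always be
    enlarged by a vector that m multiplies into it. *)
Lemma injective_from_m (C : lmodType R) :
  (forall h : {linear submod m -> C}, exists z : C,
    forall a : submod m, h a = (val a : R) *: z) -> injective_mod C.
Proof. by move=> ext_m U V g f gi; apply: baer_ext. Qed.

(* Given h : m -> K, extend it to x in E; its image in C is killed by m, hence
   is s y for some y because C is injective and R s ~ R/m; lifting y to E and
   subtracting s y from x corrects x to an element of K. *)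
Lemma injective_ker (K E C : lmodType R) (i : {linear K -> E}) (q : {linear E -> C})
    (s : R) :
  injf i -> surjf q -> (forall v, q v = 0 <-> exists k, i k = v) ->
  injective_mod E -> injective_mod C ->
  (forall a : R, a \in m -> a * s = 0) -> (forall a : R, a * s = 0 -> a \in m) ->
  injective_mod K.
Proof.
move=> ii qs qi injE injC sm ms; apply: injective_from_m => h.
have vi : injf (val : {linear submod m -> R^o}) by move=> a a0; apply: val_inj; rewrite a0.
have [hE hEE] := injE _ _ (val : {linear submod m -> R^o}) (i \o h) (injfP vi).
have hE1 (a : R^o) : hE a = (a : R) *: hE 1 by rewrite -linearZ /= /GRing.scale /= mulr1.
have mqx (a : R) : a \in m -> a *: q (hE 1) = 0.
  move=> am; rewrite -linearZ -hE1; apply/qi.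
  by exists (h (Submod am)); exact: esym (hEE (Submod am)).
have lR (V : lmodType R) (v : V) : linear (fun a : R^o => (a : R) *: v).
  by move=> a x y; rewrite scalerDl scalerA.
have [fs fsE] := linear_exists (lR _ (s : R^o)).
have [fx fxE] := linear_exists (lR _ (q (hE 1))).
have [|g gE] := injective_ext (h := fs) (f := fx) injC.
  by move=> a; rewrite fsE fxE => /ms; apply: mqx.
have gs : q (hE 1) = s *: g 1.
  have := gE 1; rewrite fsE fxE !scale1r => <-.
  by rewrite -linearZ /=; congr (g _); rewrite /GRing.scale /= mulr1.
have [e eE] := qs (g 1).
have [z zE] : exists z, i z = hE 1 - s *: e.
  by apply/qi; rewrite linearB linearZ /= eE gs subrr.
exists z => a; apply: (injfP ii); rewrite linearZ /= zE scalerBr scalerA.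
by rewrite sm ?scale0r ?subr0 ?(valP a) // -hE1; exact: esym (hEE a).
Qed.

(** Descending induction on the cocycles [C j] of a finite injective resolution: [injective_ker]
    passes injectivity from [C j.+1] to [C j] along 0 -> C j -> E j -> C j.+1 -> 0. It starts from
    [C n.+1], which is 0, and ends at [C 0], which is isomorphic to R. *)
Lemma self_injective (s : R) :
  (forall a : R, a \in m -> a * s = 0) -> (forall a : R, a * s = 0 -> a \in m) ->
  gorenstein R -> injective_mod (R^o : lmodType R).
Proof.
move=> sm ms [n [E E0]].
pose C i : lmodType R := ker_mod (ir_d E i).
pose inc i : {linear C i -> E i} := val.
have injinc i : injf (inc i) by move=> u u0; apply: val_inj; rewrite u0.
have incE i v : ir_d E i v = 0 <-> exists k, inc i k = v.
  split=> [dv|[k <-]]; last exact/eqP/(valP k).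
  have kv : v \in ker_pred (ir_d E i) by apply/eqP.
  by exists (Submod kv).
have injC i : (i <= n.+1)%N -> injective_mod (C (n.+1 - i)%N).
  elim: i => [_|i IHi ilt].
    rewrite subn0 => U V g f gi.
    have [h hE] := @linear_zero R V (C n.+1).
    by exists h => u; apply: (injfP (injinc _)); transitivity (0 : E n.+1); [|symmetry]; apply: E0.
  set j := (n.+1 - i.+1)%N.
  have jS : (n.+1 - i)%N = j.+1 by rewrite /j subSS subSn // -ltnS.
  have := IHi (ltnW ilt); rewrite jS => injCj.
  have [|q qE] := linear_lift_inj (i := inc j.+1) (f := ir_d E j) (injinc _).
    by move=> v; apply/incE/ir_exact; exists v.
  apply: (injective_ker (i := inc j) (q := q) (s := s)) => //.
  - move=> c; have /incE/ir_exact[v vE] : exists k, inc j.+1 k = inc j.+1 c by exists c.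
    by exists v; apply: (injfP (injinc _)); rewrite qE.
  - move=> v; rewrite -incE -qE; split=> [->|/injinc//].
    by rewrite linear0.
  - exact: ir_inj.
have {}injC : injective_mod (C 0%N) by have := injC n.+1 (leqnn _); rewrite subnn.
have [|phi phiE] := linear_lift_inj (i := inc 0%N) (f := ir_aug E) (injinc _).
  by move=> v; apply/incE/ir_exact0; exists v.
have [|psi psiE] := linear_lift_inj (i := ir_aug E) (f := inc 0%N) (injfI (@ir_mono _ _ E)).
  by move=> v; apply/ir_exact0/incE; exists v.
move=> U V g f gi; have [h hE] := injC U V g (phi \o f) gi.
exists (psi \o h) => u; apply: (@ir_mono _ _ E).
by rewrite [LHS]psiE hE [LHS]phiE.
Qed.

End Injectivity.

(** * Submodules m S, socles and bases *)

Section MaximalIdeal.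
Variables (R : comNzRingType) (m : submodClosed R^o).
Implicit Types U V W X Z : lmodType R.

Definition msub V (S : V -> Prop) : V -> Prop :=
  fun v => v \in span (fun w => exists a x, [/\ a \in m, S x & w = a *: x]).

Definition soc V : V -> Prop := fun x => forall a : R, a \in m -> a *: x = 0.

Lemma issub_msub V (S : V -> Prop) : issub (msub S).
Proof. exact: issub_closed. Qed.

Lemma issub_soc V : issub (@soc V).
Proof.
split=> [a am|a u v su sv b bm]; first by rewrite scaler0.
by rewrite scalerDr sv // scalerA mulrC -scalerA su // scaler0 addr0.
Qed.

Lemma msub_gen V (S : V -> Prop) (a : R) x : a \in m -> S x -> msub S (a *: x).
Proof. by move=> am Sx; apply: span_gen; exists a, x. Qed.

Lemma msub_min V (S T : V -> Prop) : issub T ->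
  (forall (a : R) x, a \in m -> S x -> T (a *: x)) -> forall v, msub S v -> T v.
Proof. by move=> sT aT; apply: span_min => // v [a [x [am Sx ->]]]; apply: aT. Qed.

Lemma msub_mono V (S T : V -> Prop) : (forall v, S v -> T v) -> forall v, msub S v -> msub T v.
Proof.
move=> ST; apply: msub_min => [|a x am Sx]; first exact: issub_msub.
by apply: msub_gen => //; apply: ST.
Qed.

Lemma msub_sub V (S : V -> Prop) : issub S -> forall v, msub S v -> S v.
Proof. by move=> sS; apply: msub_min => // a x _; apply: issubZ. Qed.

Lemma imsub_msub U V (f : {linear U -> V}) (S : U -> Prop) v :
  imsub f (msub S) v <-> msub (imsub f S) v.
Proof.
split=> [[u [Su <-]]|].
  move: u Su; apply: msub_min; first exact/issub_pre/issub_msub.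
  by move=> a x am Sx; rewrite linearZ; apply: msub_gen => //; exists x.
move: v; apply: msub_min; first exact/issub_im/issub_msub.
move=> a _ am [x [Sx <-]]; exists (a *: x).
by rewrite linearZ; split=> //; apply: msub_gen.
Qed.

Lemma soc_im U V (f : {linear U -> V}) u : soc u -> soc (f u).
Proof. by move=> su a am; rewrite -linearZ su // linear0. Qed.

Lemma soc_inj U V (f : {linear U -> V}) u : injf f -> soc (f u) -> soc u.
Proof. by move=> fi su a am; apply: fi; rewrite linearZ; apply: su. Qed.

Section Cubed.
Hypothesis m3 : forall a b c : R, a \in m -> b \in m -> c \in m -> a * b * c = 0.

(** Nilpotence of m replaces finite generation: V = S + m V iterates to V = S + m^3 V, and m^3 V =
    0. *)
Lemma nakayama V (S : V -> Prop) : issub S ->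
  (forall v, exists u, S u /\ msub (@full _ V) (v - u)) -> forall v, S v.
Proof.
move=> sS SD.
pose D k := iter k (@msub V) (@full _ V).
have SDk k v : exists u, S u /\ D k (v - u).
  elim: k v => [|k IHk] v; first by exists 0; split=> //; apply: issub0.
  have [u [Su]] := SD v.
  suff H : forall x, msub (@full _ V) x -> exists y, S y /\ D k.+1 (x - y).
    move=> /H[y [Sy Dy]]; exists (u + y); split; first exact: issubD.
    by rewrite opprD addrA.
  apply: msub_min => [|a x am _].
    split=> [|a x y [u' [Su' Du']] [v' [Sv' Dv']]].
      by exists 0; rewrite subr0; split; [apply: issub0|apply: issub0; apply: issub_msub].
    exists (a *: u' + v'); split; first exact: sS.2.
    have -> : a *: x + y - (a *: u' + v') = a *: (x - u') + (y - v').
      by rewrite scalerBr opprD addrACA.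
    exact: (issub_msub _).2.
  have [y [Sy Dy]] := IHk x; exists (a *: y); split; first exact: issubZ.
  by rewrite -scalerBr; apply: msub_gen.
have D1 : forall v, D 1 v -> forall a b : R, a \in m -> b \in m -> (a * b) *: v = 0.
  move=> v Dv a b am bm; move: v Dv; apply: msub_min.
    by split=> [|c x y xE yE]; rewrite ?scaler0 // scalerDr yE scalerA mulrC -scalerA xE scaler0 addr0.
  by move=> c x cm _; rewrite scalerA m3 // scale0r.
have D2 : forall v, D 2 v -> soc v.
  apply: msub_min => [|a x am Dx b bm]; first exact: issub_soc.
  by rewrite scalerA D1.
have D3 : forall v, D 3 v -> v = 0.
  by apply: msub_min => [|a x am /D2]; [apply: issub_zero|apply].
by move=> v; have [u [Su /D3/eqP]] := SDk 3 v; rewrite subr_eq0 => /eqP ->.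
Qed.

End Cubed.

Section Basis.
Hypothesis m_unit : forall u : R, u \notin m -> exists v : R, v * u = 1.

(** The basis grows along a maximal chain: a basis of the lower term [T] is completed by a vector
    [y] outside it. In a relation the coefficient of [y] is in m, since a unit there would put [y]
    in [T]; it then kills [y] and leaves a relation in [T]. *)
Lemma basis_exists V (S : V -> Prop) : issub S -> finlen S -> (forall v, S v -> soc v) ->
  exists x : 'I_(len S) -> V,
    [/\ forall i, S (x i), forall v, S v -> exists w, v = comb x w
      & forall w, comb x w = 0 -> forall i, w 0 i \in m].
Proof.
move=> + fS; have [n nE] : exists n, n = len S by exists (len S).
rewrite -nE; elim: n S fS nE => [|n IHn] S fS nE sS Ssoc.
  exists (fun=> 0); split=> [[]//|v Sv|w _ []//].
  by exists 0; rewrite linear0; apply: (len_eq0 sS).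
have [T [sT TS [y [Sy Ty]] lT]] : lge n.+1 S by rewrite nE; apply/lgeE.
have [fT lTS] := len_sub TS fS.
have lTn : n = len T.
  apply/eqP; rewrite eqn_leq; apply/andP; split; first exact/lgeE.
  rewrite leqNgt; apply/negP => nT; apply: Ty.
  by apply: (len_sub_eq sT TS fS) => //; rewrite -nE.
have [x [Tx xs xi]] := IHn T fT lTn sT (fun v Tv => Ssoc v (TS v Tv)).
pose z (i : 'I_n.+1) := if unlift ord0 i is Some j then x j else y.
have combE w : comb z w = w 0 ord0 *: y + comb x (\row_j w 0 (lift ord0 j)).
  rewrite /comb big_ord_recl /z unlift_none; congr (_ + _).
  by apply: eq_bigr => i _; rewrite liftK mxE.
have Sz i : S (z i) by rewrite /z; case: unliftP => [j _|_] //; apply: TS.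
exists z; split=> //.
  (* Spanning by a length count: the span [S'] strictly contains [T], so it has length at least
     [n.+1], the length of [S]. *)
  move=> v Sv; pose S' u := exists w, u = comb z w.
  have sS' : issub S'.
    split=> [|a _ _ [w ->] [w' ->]]; first by exists 0; rewrite linear0.
    by exists (a *: w + w'); rewrite linearP.
  have S'S u : S' u -> S u by move=> [w ->]; apply: comb_sub.
  apply: (len_sub_eq sS' S'S fS) => //; rewrite -nE.
  have fS' : finlen S' by have [] := len_sub S'S fS.
  apply/(lgeE _ fS'); exists T; split=> //.
    move=> u Tu; have [w ->] := xs u Tu.
    exists (\row_i if unlift ord0 i is Some j then w 0 j else 0).
    rewrite combE mxE unlift_none scale0r add0r; congr comb.
    by apply/rowP => j; rewrite !mxE liftK.
  exists y; split=> //; exists (delta_mx 0 ord0).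
  by rewrite comb_delta /z unlift_none.
move=> w; rewrite combE => w0.
have w0m : w 0 ord0 \in m.
  apply: contrapT => /negP/m_unit[v vw]; apply: Ty.
  have -> : y = v *: (w 0 ord0 *: y) by rewrite scalerA vw scale1r.
  apply: issubZ => //; move/eqP: w0; rewrite addr_eq0 => /eqP ->.
  by apply: issubN => //; apply: comb_sub.
move=> i; case: (unliftP ord0 i) => [j ->|-> //].
have /xi/(_ j) : comb x (\row_j w 0 (lift ord0 j)) = 0.
  by move: w0; rewrite (Ssoc y Sy _ w0m) add0r.
by rewrite mxE.
Qed.

End Basis.
End MaximalIdeal.

(** * Free modules over a short Gorenstein ring *)

Lemma len_coord (R : comNzRingType) b (T : R^o -> Prop) : finlen (@full R R^o) -> issub T ->
  finlen (fun v : 'rV[R]_b => forall i, T (v 0 i)) /\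
  len (fun v : 'rV[R]_b => forall i, T (v 0 i)) = (b * len T)%N.
Proof.
move=> finR sT; have lc i : linear (fun v : 'rV[R]_b => v 0 i : R^o) by move=> a u v; rewrite !mxE.
have /choice[g gE] : forall i, exists g : {linear 'rV[R]_b -> R^o}, forall v, g v = v 0 i.
  by move=> i; have [g] := linear_exists (lc i); exists g.
have fT : finlen T by have [] := len_sub (S := T) _ finR.
apply: (len_power (g := g)) => //.
- split=> [i|a u v Tu Tv i]; rewrite !mxE; first exact: (issub0 sT).
  exact: (sT.2 a).
- by move=> v Tv i; rewrite gE.
- by move=> t Tt; exists (\row_i t i); split=> [i|i]; rewrite ?gE mxE.
- by move=> v _ v0; apply/rowP => i; rewrite -gE v0 mxE.
Qed.

(* The element s spans the socle, which is m^2. *)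
Record short_gorenstein (R : comNzRingType) (m : submodClosed R^o) (s : R) (e : nat) : Prop :=
  ShortGorenstein {
  sg_unit : forall u : R, u \notin m -> exists v : R, v * u = 1;
  sg_m3 : forall a b c : R, a \in m -> b \in m -> c \in m -> a * b * c = 0;
  sg_prod : exists a b : R, [/\ a \in m, b \in m & s = a * b];
  sg_soc : forall x : R, (forall a : R, a \in m -> a * x = 0) -> exists r, x = r * s;
  sg_ann : forall a : R, a * s = 0 -> a \in m;
  sg_inj : injective_mod (R^o : lmodType R);
  sg_fin : finlen (@full R R^o);
  sg_len : len (@full R R^o) = e.+2;
  sg_lenm : len (fun x : R^o => x \in m) = e.+1;
  sg_lens : len (fun x : R^o => exists r : R, x = r * s) = 1%N;
  sg_e : (2 < e)%N }.

Section ShortGorensteinRing.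
Variables (R : comNzRingType) (m : submodClosed R^o) (s : R) (e : nat).
Hypothesis sg : short_gorenstein m s e.
Implicit Types U V W X Z K L N Y : lmodType R.

Local Notation msub := (msub m).
Local Notation soc := (@soc R m _).

Definition msq0 V (S : V -> Prop) :=
  forall x (a b : R), S x -> a \in m -> b \in m -> a *: (b *: x) = 0.

Lemma m_s (a : R) : a \in m -> a * s = 0.
Proof.
have [b [c [bm cm ->]]] := sg_prod sg => am; rewrite mulrA; exact: (sg_m3 sg).
Qed.

Lemma s_neq0 : s <> 0.
Proof.
move=> s0; have := sg_lens sg; rewrite (len0 _).2 // => x [r ->].
by rewrite s0 mulr0.
Qed.

Lemma mm_s (a b : R) : a \in m -> b \in m -> exists r, a * b = r * s.
Proof. by move=> am bm; apply: (sg_soc sg) => c cm; rewrite mulrA (sg_m3 sg). Qed.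

Lemma s_m : s \in m.
Proof.
have [b [c [bm cm ->]]] := sg_prod sg.
by have := issubZ (issub_closed m) b cm.
Qed.

Lemma mul_m (a b : R) : b \in m -> a * b \in m.
Proof. by move=> bm; have := issubZ (issub_closed m) a bm. Qed.

Lemma msq0_scale V (S : V -> Prop) x : msq0 S -> S x -> s *: x = 0.
Proof.
move=> S0 Sx; have [b [c [bm cm ->]]] := sg_prod sg.
by rewrite -scalerA S0.
Qed.

Lemma scale_msq0 V (S : V -> Prop) : (forall x, S x -> s *: x = 0) -> msq0 S.
Proof.
move=> S0 x a b Sx am bm; rewrite scalerA; have [r ->] := mm_s am bm.
by rewrite -scalerA S0 // scaler0.
Qed.

Lemma msq0_msub_soc V (S : V -> Prop) : msq0 S -> forall v, msub S v -> soc v.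
Proof.
move=> S0; apply: msub_min; first exact: issub_soc.
by move=> a x am Sx b bm; rewrite S0.
Qed.

Section FreeModule.
Variable b : nat.
Implicit Types v w : 'rV[R]_b.

Definition mfree v := forall i, v 0 i \in m.

(** With F the free module, s F is both m^2 F and the socle of F, since m^2 = R s is the socle of
    R. *)
Definition sfree v := exists w, v = s *: w.

Lemma issub_mfree : issub mfree.
Proof.
split=> [i|a u v um vm i]; rewrite !mxE; first exact: rpred0.
exact: ((issub_closed m).2 a).
Qed.

Lemma issub_sfree : issub sfree.
Proof.
split=> [|a _ _ [u ->] [v ->]]; first by exists 0; rewrite scaler0.
by exists (a *: u + v); rewrite scalerDr !scalerA mulrC.
Qed.

Lemma s_mfree v : s *: v = 0 <-> mfree v.
Proof.
split=> [sv i|vm]; last by apply/rowP => i; rewrite !mxE mulrC m_s.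
by apply: (sg_ann sg); move/rowP/(_ i): sv; rewrite !mxE mulrC.
Qed.

Lemma soc_sfree v : soc v <-> sfree v.
Proof.
split=> [sv|[w ->] a am]; last by rewrite scalerA m_s ?scale0r.
have /choice[r rP] : forall i, exists r, v 0 i = r * s.
  by move=> i; apply: (sg_soc sg) => a /sv/rowP/(_ i); rewrite !mxE.
by exists (\row_i r i); apply/rowP => i; rewrite !mxE mulrC.
Qed.

Lemma mfree_msub v : mfree v <-> msub (@full _ _) v.
Proof.
split=> [vm|].
  rewrite [v]row_sum_delta; apply: issub_sum; first exact: issub_msub.
  by move=> i; apply: msub_gen.
move: v; apply: msub_min; first exact: issub_mfree.
by move=> a x am _ i; rewrite mxE mulrC mul_m.
Qed.

Lemma mfree_scale (a : R) v : a \in m -> mfree v -> sfree (a *: v).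
Proof.
move=> am vm; apply/soc_sfree => c cm; apply/rowP => i.
by rewrite !mxE mulrA (sg_m3 sg).
Qed.

Lemma finlen_free (S : 'rV[R]_b -> Prop) : finlen S.
Proof.
have [f _] := len_coord b (sg_fin sg) (issub_full R^o).
by have [] := len_sub (S := S) _ f.
Qed.

Lemma len_free : len (@full R 'rV[R]_b) = (b * e.+2)%N.
Proof.
have [_] := len_coord b (sg_fin sg) (issub_full R^o); rewrite (sg_len sg) => <-.
exact: len_ext.
Qed.

Lemma len_mfree : len mfree = (b * e.+1)%N.
Proof. by have [_] := len_coord b (sg_fin sg) (issub_closed m); rewrite (sg_lenm sg). Qed.

Lemma len_sfree : len sfree = b.
Proof.
have [_] := len_coord b (sg_fin sg) (issub_principal s); rewrite (sg_lens sg) muln1 => {2}<-.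
apply: len_ext => v; split=> [[w ->] i|]; first by exists (w 0 i); rewrite mxE mulrC.
by move=> /choice[r rP]; exists (\row_i r i); apply/rowP => i; rewrite !mxE mulrC.
Qed.

End FreeModule.

(** If [g (s w) = s v], then s kills [v - g w], which therefore lies in m times the target; Nakayama
    concludes. It thus suffices to reach the socle from s F. *)
Lemma free_surj b c (g : {linear 'rV[R]_b -> 'rV[R]_c}) :
  (forall v, exists w, g (s *: w) = s *: v) -> surjf g.
Proof.
move=> gs; have sI : issub (imsub g (@full _ _)) by apply: issub_im.
suff H : forall v, imsub g (@full _ _) v by move=> v; have [u [_ <-]] := H v; exists u.
apply: (nakayama (sg_m3 sg) sI) => v; have [w gw] := gs v.
exists (g w); split; first by exists w.
by apply/mfree_msub/s_mfree; rewrite scalerBr -gw linearZ subrr.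
Qed.

Lemma soc_inj_free b V (g : {linear 'rV[R]_b -> V}) :
  (forall w, g (s *: w) = 0 -> s *: w = 0) -> injf g.
Proof.
move=> gs v gv; apply: contrapT => v0.
have [r [rv0 rvs]] := essential_multiple (sg_m3 sg) (issub_zero 'rV[R]_b) v0.
have [w rvE] : sfree (r *: v) by apply/soc_sfree.
by apply: rv0; rewrite rvE; apply: gs; rewrite -rvE linearZ_LR gv scaler0.
Qed.

(** The i-th vector of a basis of [S] goes to s times the i-th unit vector; this is well defined and
    injective because the annihilator of s is m. Self-injectivity of R extends the map to [V]. *)
Lemma embedding V (S : V -> Prop) : issub S -> finlen S -> (forall v, S v -> soc v) ->
  exists f : {linear V -> 'rV[R]_(len S)},
    (forall v, S v -> f v = 0 -> v = 0) /\ forall w, exists v, S v /\ f v = s *: w.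
Proof.
move=> sS fS Ssoc; have [x [Sx xs xi]] := basis_exists (sg_unit sg) sS fS Ssoc.
have [|f0 f0E] := @linear_exists R 'rV[R]_(len S) 'rV[R]_(len S) (fun w => s *: w).
  by move=> a u v; rewrite scalerDr !scalerA mulrC.
have [|f fE] := injective_ext (h := comb x) (f := f0) (rV_injective (sg_inj sg)).
  by move=> w /xi wm; rewrite f0E; apply/s_mfree.
exists f; split=> [v /xs[w ->]|w]; rewrite ?fE ?f0E.
  move=> /s_mfree wm; rewrite /comb big1 // => i _; exact: (Ssoc _ (Sx i) _ (wm i)).
by exists (comb x w); rewrite fE f0E; split=> //; apply: comb_sub.
Qed.

(** Some multiple of [v] spans a copy of R/m, which is sent onto R s; injectivity of R extends this
    to [V]. *)
Lemma nonzero_functional V (v : V) : v <> 0 -> exists f : {linear V -> R^o}, f v <> 0.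
Proof.
move=> v0; have [r [rv0 rvs]] := essential_multiple (sg_m3 sg) (issub_zero V) v0.
have l1 : linear (fun a : R^o => (a : R) *: (r *: v)).
  by move=> a x y; rewrite scalerDl -[(a *: x) *: _]scalerA.
have l2 : linear (fun a : R^o => (a * s : R^o)) by move=> a x y; rewrite mulrDl scalerAl.
have [h hE] := linear_exists l1; have [k kE] := linear_exists l2.
have [a|f fE] := injective_ext (h := h) (f := k) (sg_inj sg).
  rewrite hE kE => av; apply: m_s; apply: contrapT => /negP/(sg_unit sg)[u ua].
  by apply: rv0; rewrite -[r *: v]scale1r -ua -scalerA av scaler0.
exists f => fv; have := fE (1 : R^o); rewrite hE kE scale1r mul1r linearZ /= fv scaler0.
by move/esym; apply: s_neq0.
Qed.

End ShortGorensteinRing.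

(** * Growth along syzygies and cosyzygies *)

Definition ses (R : comNzRingType) (K F X : lmodType R) (i : {linear K -> F})
    (p : {linear F -> X}) : Prop :=
  [/\ injf i, surjf p & forall v, p v = 0 <-> exists k, i k = v].

Section Growth.
Variables (R : comNzRingType) (m : submodClosed R^o) (s : R) (e : nat).
Hypothesis sg : short_gorenstein m s e.
Implicit Types U V W X Z K L N Y : lmodType R.

Local Notation msub := (msub m).
Local Notation soc := (@soc R m _).
Local Notation msq0 := (msq0 m).
Local Notation mfree := (mfree m).
Local Notation sfree := (sfree s).

(* X has a quotient I (the range of f) with m^2 I = 0,
   length (I/soc I) <= length (m I) and length (m I) >= q. *)
Definition wide_quot X q := exists Z (f : {linear X -> Z}),
  let I := imsub f (@full _ X) in
  [/\ finlen I, msq0 I, (len I <= len (msub I) + len (capsub I soc))%N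
    & (q <= len (msub I))%N].

(* L has a submodule I with m^2 I = 0, length (m I) <= length (I/soc I) and
   length (I/soc I) >= q. *)
Definition wide_sub L q := exists I : L -> Prop,
  [/\ issub I, finlen I, msq0 I, (len (msub I) + len (capsub I soc) <= len I)%N
    & (q + len (capsub I soc) <= len I)%N].

Lemma imsub_full U V (f : {linear U -> V}) : surjf f -> imsub f (@full _ U) = @full _ V.
Proof.
move=> fs; apply/funext => v; apply/propext; split=> // _.
by have [u <-] := fs v; exists u.
Qed.

Lemma msub_full_im U V (f : {linear U -> V}) u : msub (@full _ U) u -> msub (@full _ V) (f u).
Proof.
move=> mu; have /imsub_msub : imsub f (msub (@full _ U)) (f u) by exists u.
exact: msub_mono.
Qed.

Lemma capsub_soc_msub V (S : V -> Prop) : issub S -> msq0 S ->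
  forall v, msub S v -> capsub S soc v.
Proof. by move=> sS S0 v Sv; split; [apply: msub_sub Sv|apply: msq0_msub_soc Sv]. Qed.

Lemma len_msub_soc V (S : V -> Prop) : issub S -> msq0 S -> finlen S ->
  (len (msub S) <= len (capsub S soc))%N.
Proof.
move=> sS S0 fS; have [fc _] : finlen (capsub S soc) /\ (len (capsub S soc) <= len S)%N.
  by apply: len_sub => // v [].
by have [] := len_sub (capsub_soc_msub sS S0) fc.
Qed.

Lemma wide_quot_syzygy K b X (i : {linear K -> 'rV[R]_b}) (p : {linear 'rV[R]_b -> X}) q :
  ses i p -> (forall k, mfree (i k)) -> wide_quot K q -> wide_quot X (2 * q).
Proof.
move=> [ii ps pk] im [Z [f]] /=; set I := imsub f (@full _ K) => -[fI I0 lI qI].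
have sI : issub I by apply: issub_im.
have smI : issub (msub I) by apply: issub_msub.
have mI_I v : msub I v -> I v by apply: msub_sub.
have [fmI _] := len_sub mI_I fI.
have [g [gi gs]] := embedding sg smI fmI (msq0_msub_soc I0).
set c := len (msub I) in g gi gs *.
have [|G GE] := injective_ext (h := i) (f := g \o f) (rV_injective (n := c) (sg_inj sg)).
  by move=> k /ii ->; rewrite linear0.
(* Each [s *: v] is the value of [g \o f] at some element of m K, and [i] maps m K into m (m F),
   hence into s F: the socle is reached from s F. *)
have Gs : surjf G.
  apply: (free_surj sg) => v; have [z [mz gz]] := gs v.
  have [k [mk fk]] := (imsub_msub m f _ _).2 mz.
  have [w iw] : sfree (i k).
    move: k mk {fk}; apply: msub_min; first exact/issub_pre/issub_sfree.
    by move=> a x am _; rewrite linearZ; apply: (mfree_scale sg am (im x)).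
  by exists w; rewrite -iw GE /= fk gz.
pose J := imsub g I; have sJ : issub J by apply: issub_im.
have [Y [r [rs rk]]] := quot_exists sJ.
have [|phi phiE] := linear_lift_surj (f := r \o G) ps.
  move=> v /pk[k <-] /=; rewrite GE; apply/rk; exists (f k); split=> //.
  by exists k.
have phis : surjf phi.
  move=> y; have [w <-] := rs y; have [v <-] := Gs w.
  by exists (p v); rewrite phiE.
exists Y, phi; rewrite /= (imsub_full phis).
have frc := finlen_free sg (@full R 'rV[R]_c).
have fY : finlen (@full R Y) by rewrite -(imsub_full rs); apply: finlen_im.
have Y0 : msq0 (@full R Y).
  apply: (scale_msq0 sg) => y _; have [w <-] := rs y; rewrite -linearZ; apply/rk.
  by have [z [mz gz]] := gs w; exists z; split=> //; apply: mI_I.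
have Jm v : J v -> mfree v.
  by move=> [z [Iz <-]]; apply/(s_mfree sg); rewrite -linearZ (msq0_scale sg I0) // linear0.
have lY : (c * e.+2 = len J + len (@full R Y))%N.
  rewrite -(len_free sg) (lenD r (issub_full _) frc) (imsub_full rs); congr addn.
  by apply: len_ext => v; rewrite -rk; split=> [[]|].
have lmY : (c * e.+1 = len J + len (msub (@full R Y)))%N.
  rewrite -(len_mfree sg c) (lenD r (issub_mfree m c) (finlen_free sg _)); congr addn.
    by apply: len_ext => v; split=> [[_ /rk]//|Jv]; split; [apply: Jm|apply/rk].
  apply: len_ext => y; rewrite -(imsub_full rs) -imsub_msub.
  by split=> -[w [mw <-]]; exists w; split=> //; apply/mfree_msub.
(* [g] maps soc I onto the socle of R^c, of length c, and what remains of [J] is a quotient of I/soc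
   I, of length at most c by the width of [I]. *)
have lJ : (len J <= c + c)%N.
  pose S0 := capsub I soc.
  have sS0 : issub S0 by apply: issub_cap => //; apply: issub_soc.
  have [fS0 _] : finlen S0 /\ (len S0 <= len I)%N by apply: len_sub => // v [].
  have lIE := lenD g sI fI; have lSE := lenD g sS0 fS0.
  have [_ kl] : finlen (kersub g S0) /\ (len (kersub g S0) <= len (kersub g I))%N.
    by apply: len_sub; [move=> v [[]]|apply: finlen_ker].
  have sE : len (imsub g S0) = c.
    rewrite -[RHS](len_sfree sg); apply: len_ext => v; split=> [[z [[Iz sz] <-]]|[w ->]].
      by apply/(soc_sfree sg)/soc_im.
    have [z [mz gz]] := gs w; exists z; split=> //; exact: capsub_soc_msub.
  move: lI lIE lSE kl; rewrite sE -/S0 -/J -/c; clearbody c.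
  move: (len I) (len S0) (len (kersub g I)) (len J) (len (kersub g S0)) => *; lia.
(* At this point len Y = c + len (m Y) and len (m Y) >= (e - 1) c >= 2 c. As m Y lies in soc Y, also
   c <= len (soc Y), which is the inequality required of [Y]. *)
have lms := len_msub_soc (issub_full Y) Y0 fY.
split=> //; have := sg_e sg; move: lY lmY lms lJ qI; rewrite -/c; clearbody c.
  by move: (len J) (len (@full R Y)) (len (msub (@full R Y))) (len (capsub (@full R Y) soc)) => *; nia.
by move: (len J) (len (@full R Y)) (len (msub (@full R Y))) (len (capsub (@full R Y) soc)) => *; nia.
Qed.

(** Let a = length (I/soc I). Lifts of a basis of I/soc I to F define an embedding [g] of R^a, and
    the new submodule [Y] consists of the elements of N that [i] sends into its image. It is
    isomorphic to the kernel of R^a -> L, its socle has length a, and its length is at least e a. *)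
Lemma wide_sub_syzygy N b L (i : {linear N -> 'rV[R]_b}) (p : {linear 'rV[R]_b -> L}) q :
  ses i p -> (forall w, exists k, i k = s *: w) -> wide_sub L q -> wide_sub N (2 * q).
Proof.
move=> [ii ps pk] sN [I [sI fI I0 lI qI]].
have L0 : msq0 (@full R L).
  by apply: (scale_msq0 sg) => y _; have [w <-] := ps y; rewrite -linearZ; apply/pk/sN.
have [D [t [ts tk]]] := quot_exists (issub_soc m L).
pose tI := imsub t I.
have stI : issub tI by apply: issub_im.
have ftI : finlen tI by apply: finlen_im.
have lIE : (len I = len (capsub I soc) + len tI)%N.
  rewrite (lenD t sI fI); congr addn; apply: len_ext => v.
  by split=> -[Iv /tk].
have tsoc v : tI v -> soc v.
  move=> [x [Ix <-]] a am; rewrite -linearZ; apply/tk => c cm; exact: I0.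
have [a aE] : exists a, len tI = a by exists (len tI).
have := basis_exists (sg_unit sg) stI ftI tsoc; rewrite aE in lIE * => -[d [tId _ di]].
have /choice[x xP] : forall j, exists x, I x /\ t x = d j by move=> j; apply: tId.
have /choice[f fP] : forall j, exists w, p w = x j by move=> j; apply: ps.
pose g : {linear 'rV[R]_a -> 'rV[R]_b} := comb f.
pose h : {linear 'rV[R]_a -> L} := comb x.
have pg w : p (g w) = h w.
  by rewrite linear_comb; apply: eq_bigr => j _; rewrite fP.
have hI w : I (h w) by apply: comb_sub => // j; have [] := xP j.
have soc_h w : soc (h w) -> mfree w.
  move=> /tk; rewrite linear_comb => hw; apply: di; rewrite -[RHS]hw.
  by apply: eq_bigr => j _; have [_ ->] := xP j.
(* Tested on the socle: if [g (s w) = 0], then s kills [g w], so [g w] is in m F and [h w] in m L,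
   hence in the socle; by independence modulo soc I, [w] has its coordinates in m. *)
have gi : injf g.
  apply: (soc_inj_free sg) => w gw; apply/(s_mfree sg)/soc_h.
  have /mfree_msub mgw : mfree (g w) by apply/(s_mfree sg); rewrite -linearZ.
  by rewrite -pg; apply: (msq0_msub_soc L0); apply: msub_full_im.
pose Y0 w := h w = 0.
pose Y n := exists w, i n = g w.
have sY0 : issub Y0.
  by split=> [|c u v]; rewrite /Y0 ?linear0 // linearP => -> ->; rewrite scaler0 addr0.
have sY : issub Y.
  split=> [|c u v [w uw] [w' vw']]; first by exists 0; rewrite !linear0.
  by exists (c *: w + w'); rewrite !linearP uw vw'.
have YY0 n w : i n = g w -> Y0 w by rewrite /Y0 -pg => <-; apply/pk; exists n.
have Y0Y w : Y0 w -> exists n, i n = g w by rewrite /Y0 -pg => /pk.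
have ffree c (S : 'rV[R]_c -> Prop) : finlen S by apply: (finlen_free sg).
have fY : finlen Y by apply: (finlen_inj (f := i)) => // n _ /ii.
have lY : len Y = len Y0.
  rewrite -(len_imsub_inj (f := i) sY) // => [|n _ /ii//].
  rewrite -(len_imsub_inj (f := g) sY0) // => [|w _ /gi//].
  apply: len_ext => v; split=> [[n [[w nw] <-]]|[w [/Y0Y[n nw] <-]]].
    by exists w; split=> //; apply: YY0 nw.
  by exists n; split=> //; exists w.
have sYs : issub (capsub Y soc) by apply: issub_cap => //; apply: issub_soc.
(* Since m^2 I = 0, the socle s R^a lies in the kernel of [h]; under [i] and [g] it corresponds to
   the socle of [Y]. *)
have lYs : len (capsub Y soc) = a.
  have [fYs _] : finlen (capsub Y soc) /\ (len (capsub Y soc) <= len Y)%N.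
    by apply: len_sub => // n [].
  rewrite -(len_imsub_inj (f := i) sYs) // => [|n _ /ii//].
  rewrite -[RHS](len_sfree sg) -(len_imsub_inj (f := g) (issub_sfree s a)) // => [|w _ /gi//].
  apply: len_ext => v; split=> [[n [[[w nw] sn] <-]]|[w [sw <-]]].
    exists w; split=> //; apply/(soc_sfree sg)/(soc_inj gi).
    by rewrite -nw; apply: soc_im.
  have [n nw] : exists n, i n = g w.
    apply: Y0Y; have [w' ->] := sw; rewrite /Y0 linearZ; exact: (msq0_scale sg I0 (hI w')).
  exists n; split=> //; split; first by exists w.
  by apply: (soc_inj ii); rewrite nw; apply/soc_im/(soc_sfree sg).
have Y0m w : Y0 w -> mfree w by move=> hw; apply: soc_h => c _; rewrite hw scaler0.
have mY : msq0 Y.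
  apply: (scale_msq0 sg) => n [w nw]; apply: ii; rewrite linearZ /= nw.
  by rewrite -linearZ (s_mfree sg _).2 ?linear0 //; apply/Y0m/(YY0 n).
have lF := lenD h (issub_mfree m a) (ffree _ _); rewrite (len_mfree sg) in lF.
rewrite -(len_ext (S := Y0)) in lF; last first.
  by move=> w; split=> [Yw|[]//]; split=> //; apply: Y0m.
have lmI : (len (imsub h (fun w => mfree w)) <= len (msub I))%N.
  have [fmI _] := len_sub (msub_sub (m := m) sI) fI.
  have [] // := len_sub (S := imsub h (fun w => mfree w)) _ fmI.
  move=> _ [w [/mfree_msub mw <-]].
  have /imsub_msub : imsub h (msub (@full _ _)) (h w) by exists w.
  by apply: msub_mono => _ [w' [_ <-]].
(* As [h] maps m R^a into m I, of length at most a, len Y >= (e + 1) a - a = e a, whereas len (m Y)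
   <= len (soc Y) = a. With e >= 3 both inequalities required of [Y] follow. *)
have lmY := len_msub_soc sY mY fY; rewrite lYs in lmY.
exists Y; split=> //; have := sg_e sg; move: lI qI lIE lF lmI lmY; rewrite lYs lY {ffree}.
  by move: (len I) (len (msub I)) (len (capsub I soc)) (len (imsub h _)) (len Y0) (len (msub Y)) => *; nia.
by move: (len I) (len (msub I)) (len (capsub I soc)) (len (imsub h _)) (len Y0) (len (msub Y)) => *; nia.
Qed.

(* If m K is smaller than m^2 F, a functional on F that vanishes on m K but not
   on m^2 F is onto and maps K into m^2, so that X maps onto R/m^2, which is
   wide. *)
Lemma rad_syzygy K b X (i : {linear K -> 'rV[R]_b}) (p : {linear 'rV[R]_b -> X}) :
  ses i p -> (forall k, mfree (i k)) -> ~ wide_quot X 1 ->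
  forall w, exists k, msub (@full _ K) k /\ i k = s *: w.
Proof.
move=> [ii ps pk] im nX w; apply: contrapT => nw; apply: nX.
have [Q [q [qs qk]]] := quot_exists (issub_im i (issub_msub m (@full _ K))).
have [|f fw] := nonzero_functional sg (v := q (s *: w)).
  by move=> /qk [k kw]; apply: nw; exists k.
have fQ (k : K) (a : R) : a \in m -> f (q (a *: i k)) = 0.
  move=> am; rewrite (qk _).2 ?linear0 // -linearZ; exists (a *: k); split=> //.
  exact: msub_gen.
pose T (x : R^o) := exists r : R, x = r * s.
have sT : issub T by apply: issub_principal.
have [Z [z [zs zk]]] := quot_exists sT.
have [|psi psiE] := linear_lift_surj (f := z \o (f \o q)) ps.
  move=> v /pk[k <-]; apply: (zk _).2; apply: (sg_soc sg) => a am.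
  by rewrite -(fQ k a am) !linearZ.
(* Were [f (q w)] in m, then [f (q (s w)) = s f (q w)] would vanish. *)
have [u uw] : exists u, u * f (q w) = 1.
  apply: (sg_unit sg); apply/negP => fm; apply: fw; rewrite !linearZ /=.
  by rewrite /GRing.scale /= mulrC (m_s sg).
have psis : surjf psi.
  move=> y; have [x <-] := zs y; exists (p ((x * u) *: w)).
  have xE : x = (x * u) *: f (q w) by rewrite /GRing.scale /= -mulrA uw mulr1.
  by rewrite psiE [in RHS]xE /= !linearZ.
exists Z, psi; rewrite /= (imsub_full psis).
have fZ : finlen (@full R Z) by rewrite -(imsub_full zs); apply: finlen_im => //; apply: (sg_fin sg).
have Z0 : msq0 (@full R Z).
  apply: (scale_msq0 sg) => y _; have [x <-] := zs y; rewrite -linearZ; apply/zk.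
  by exists x; rewrite mulrC.
have lZ : (e.+2 = 1 + len (@full R Z))%N.
  rewrite -(sg_len sg) -{1}(sg_lens sg) (lenD z (issub_full _) (sg_fin sg)) (imsub_full zs).
  by congr addn; apply: len_ext => x; rewrite -/(T x) -zk; split=> [[]|].
have lmZ : (e.+1 = 1 + len (msub (@full R Z)))%N.
  have [fm _] := len_sub (S := fun x : R^o => x \in m) (fun _ _ => I) (sg_fin sg).
  rewrite -(sg_lenm sg) -{1}(sg_lens sg) (lenD z (issub_closed m) fm); congr addn.
    apply: len_ext => x; rewrite -/(T x) -zk; split=> [[]//|zx]; split=> //.
    by have [r ->] := (zk x).1 zx; apply: mul_m; apply: (s_m sg).
  apply: len_ext => y; rewrite -(imsub_full zs) -imsub_msub.
  split=> -[x [mx <-]]; exists x; split=> //.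
    by rewrite -[x]mulr1; apply: msub_gen.
  move: x mx; apply: msub_min; first exact: issub_closed.
  by move=> a x am _; rewrite /GRing.scale /= mulrC; apply: mul_m.
have lms := len_msub_soc (issub_full Z) Z0 fZ; have := sg_e sg.
split=> //; lia.
Qed.

(** The image [I] is at once a quotient of X and a submodule of L. If m I <> 0, comparing length
    (I/soc I) with length (m I) makes it a forbidden quotient in one case and a forbidden submodule
    in the other. *)
Lemma radical_killed X L : ~ wide_quot X 1 -> ~ wide_sub L 1 -> msq0 (@full R L) ->
  finlen (@full R L) -> forall (f : {linear X -> L}) x, msub (@full R X) x -> f x = 0.
Proof.
move=> nX nL L0 fL f x mx; set I := imsub f (@full R X).
have sI : issub I by apply: issub_im.
have fI : finlen I by have [] := len_sub (S := I) _ fL.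
have I0 : msq0 I by move=> y a b _; apply: L0.
have mfx : msub I (f x) by apply/imsub_msub; exists x.
have [fmI _] := len_sub (msub_sub (m := m) sI) fI.
have [l0|l1] := posnP (len (msub I)).
  exact: (len_eq0 (issub_msub m I) fmI l0).
have [le|lt] := leqP (len I) (len (msub I) + len (capsub I soc)).
  by case: nX; exists L, f.
case: nL; exists I; split=> //; first exact: ltnW.
by apply: leq_trans lt; rewrite -addSn leq_add2r; apply: ltnW.
Qed.

End Growth.

(** * Ext^1 and dimension shifting *)

Section Ext1.
Variable R : comNzRingType.
Implicit Types U V W X Z K L N F G Q T : lmodType R.

Lemma hom_linear U V (h : hom_mod U V) :
  exists f : {linear U -> V}, forall u, f u = submod_val h u.
Proof. by have /asboolP lh := valP h; apply: linear_exists. Qed.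

Lemma hom_of_linear U V (f : {linear U -> V}) :
  exists h : hom_mod U V, forall u, submod_val h u = f u.
Proof.
have hf : (f : U -> V) \in @hom_pred R U V by apply/asboolP => a u v; rewrite linearP.
by exists (Submod hf).
Qed.

Lemma hom_ext U V (h h' : hom_mod U V) :
  (forall u, submod_val h u = submod_val h' u) -> h = h'.
Proof. by move=> hh; apply: val_inj; apply/funext. Qed.

Lemma homD U V (h h' : hom_mod U V) u : submod_val (h + h') u = submod_val h u + submod_val h' u.
Proof. by []. Qed.

Lemma homZ U V a (h : hom_mod U V) u : submod_val (a *: h) u = a *: submod_val h u.
Proof. by []. Qed.

Lemma hom0 U V u : submod_val (0 : hom_mod U V) u = 0.
Proof. by []. Qed.

Lemma hom_eval U V u : exists g : {linear hom_mod U V -> V}, forall h, g h = submod_val h u.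
Proof. by apply: linear_exists => a h h'. Qed.

Definition restr K F N (i : {linear K -> F}) (h : hom_mod K N) : Prop :=
  exists g : {linear F -> N}, forall k, submod_val h k = g (i k).

Lemma lin_combination U V (a : R) (f g : {linear U -> V}) :
  exists h : {linear U -> V}, forall u, h u = a *: f u + g u.
Proof.
apply: linear_exists => b u v; rewrite !linearP /=. by rewrite !scalerA [a * b]mulrC addrACA.
Qed.

Lemma issub_restr K F N (i : {linear K -> F}) : issub (@restr K F N i).
Proof.
split=> [|a h h' [g gE] [g' gE']].
  have [z zE] := @linear_zero R F N.
  by exists z => k; rewrite zE.
have [g'' gE''] := lin_combination a g g'; exists g'' => k.
by rewrite homD homZ gE gE' gE''.
Qed.

(* T is Ext^1(F/K, N), computed as Hom(K, N) modulo the maps extending to F. *)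
Definition is_ext1 K F (i : {linear K -> F}) N T :=
  exists p : {linear hom_mod K N -> T}, quot_of (@restr K F N i) p.

Lemma ext1_exists K F (i : {linear K -> F}) N : exists T, is_ext1 i N T.
Proof. by have [Q [p]] := quot_exists (issub_restr N i); exists Q, p. Qed.

Lemma ses_lift K F X K' F' X' (i : {linear K -> F}) (p : {linear F -> X})
    (i' : {linear K' -> F'}) (p' : {linear F' -> X'}) (f : {linear X -> X'}) :
  ses i p -> ses i' p' -> projective F ->
  exists (f0 : {linear F -> F'}) (f1 : {linear K -> K'}),
    (forall v, p' (f0 v) = f (p v)) /\ (forall k, i' (f1 k) = f0 (i k)).
Proof.
move=> [ii ps pk] [ii' ps' pk'] pF.
have [f0 f0E] := pF _ _ p' (f \o p) ps'.
have [|f1 f1E] := linear_lift_inj (f := f0 \o i) ii'; last by exists f0, f1.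
by move=> k; apply/pk'; rewrite f0E /= (pk _).2 ?linear0 //; exists k.
Qed.

(** Such a map is zero in the stable module category. *)
Definition proj_factor X (h : X -> X) := exists (Q : lmodType R) (a : {linear X -> Q})
  (b : {linear Q -> X}), projective Q /\ forall x, h x = b (a x).

(** Both 1 - g0 f0 on F and a lift of 1 - g f through the projective [Q] cover 1 - g f; their
    difference lands in K, and the lift vanishes on the image of [i]. *)
Lemma ses_homotopy K F X K' F' X' (i : {linear K -> F}) (p : {linear F -> X})
    (i' : {linear K' -> F'}) (p' : {linear F' -> X'})
    (f : {linear X -> X'}) (f0 : {linear F -> F'}) (f1 : {linear K -> K'})
    (g : {linear X' -> X}) (g0 : {linear F' -> F}) (g1 : {linear K' -> K}) :
  ses i p ->
  (forall v, p' (f0 v) = f (p v)) -> (forall k, i' (f1 k) = f0 (i k)) ->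
  (forall v, p (g0 v) = g (p' v)) -> (forall k, i (g1 k) = g0 (i' k)) ->
  proj_factor (fun x => x - g (f x)) ->
  exists u : {linear F -> K}, forall k, k - g1 (f1 k) = u (i k).
Proof.
move=> [ii ps pk] f0E f1E g0E g1E [Q [a [b [pQ abE]]]].
have [B BE] := pQ _ _ p b ps.
have [psi0 psi0E] := lin_combination (-1) (g0 \o f0) idfun.
have [psi psiE'] := lin_combination (-1) (B \o (a \o p)) psi0.
have psiE v : psi v = v - g0 (f0 v) - B (a (p v)).
  by rewrite psiE' psi0E /= !scaleN1r addrC [- _ + _]addrC.
have [|u uE] := linear_lift_inj (f := psi) ii.
  by move=> v; apply/pk; rewrite psiE !linearB /= BE g0E f0E -abE subrr.
exists u => k; apply: (injfP ii); rewrite uE psiE linearB g1E f1E.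
have -> : p (i k) = 0 by apply/pk; exists k.
by rewrite !linear0 ?subr0 ?addr0.
Qed.

Lemma is_ext1_iso K F K' F' (i : {linear K -> F}) (i' : {linear K' -> F'})
    (f0 : {linear F -> F'}) (f1 : {linear K -> K'}) (g0 : {linear F' -> F})
    (g1 : {linear K' -> K}) (u : {linear F -> K}) (u' : {linear F' -> K'}) N T T' :
  (forall k, i' (f1 k) = f0 (i k)) -> (forall k, i (g1 k) = g0 (i' k)) ->
  (forall k, k - g1 (f1 k) = u (i k)) -> (forall k, k - f1 (g1 k) = u' (i' k)) ->
  is_ext1 i N T -> is_ext1 i' N T' -> iso_mod T T'.
Proof.
move=> f1E g1E uE uE' [p pq] [p' pq'].
pose r (h : hom_mod K N) (h' : hom_mod K' N) := exists D : {linear F -> N},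
  forall k, submod_val h k = submod_val h' (f1 k) + D (i k).
apply: (quot_rel_iso (r := r) pq pq').
- move=> a h1 h2 h1' h2' [D1 D1E] [D2 D2E]; have [D DE] := lin_combination a D1 D2.
  by exists D => k; rewrite !homD !homZ D1E D2E DE scalerDr addrACA.
- move=> h; have [l lE] := hom_linear h; have [h' hE'] := hom_of_linear (l \o g1).
  by exists h', (l \o u) => k; rewrite hE' /= -uE linearB addrC subrK lE.
- move=> h'; have [l lE] := hom_linear h'; have [h hE] := hom_of_linear (l \o f1).
  have [z zE] := @linear_zero R F N.
  by exists h, z => k; rewrite hE zE addr0 /= lE.
- move=> h h' [D DE]; split=> [[G GE]|[G GE]].
    have [l lE] := hom_linear h'.
    have [E EE] := lin_combination (-1) D G.
    have [E' EE'] := lin_combination 1 (E \o g0) (l \o u').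
    exists E' => k; rewrite EE' scale1r /= EE -g1E -GE DE -uE' linearB !lE scaleN1r.
    by rewrite [- _ + _]addrC addrK addrC subrK.
  have [E EE] := lin_combination 1 (G \o f0) D.
  by exists E => k; rewrite EE scale1r /= DE GE f1E.
Qed.

(** Both modules are Ext^2(X, N), obtained by shifting the first or the second argument. A map K2 ->
    N corresponds to a map K1 -> L when one [eta : F1 -> G] induces both; injectivity of G and
    projectivity of F1 provide [eta] from either side. *)
Lemma is_ext1_shift K2 F1 K1 F0 X N G L (i2 : {linear K2 -> F1}) (q : {linear F1 -> K1})
    (i1 : {linear K1 -> F0}) (p0 : {linear F0 -> X}) (j : {linear N -> G})
    (r : {linear G -> L}) T T' :
  ses i2 q -> ses i1 p0 -> ses j r -> projective F1 -> projective F0 -> injective_mod G ->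
  is_ext1 i2 N T -> is_ext1 i1 L T' -> iso_mod T T'.
Proof.
move=> [ii2 qs qk] [ii1 _ _] [ij rs rk] pF1 pF0 injG [p pq] [p' pq'].
pose rel (h : hom_mod K2 N) (h' : hom_mod K1 L) := exists eta : {linear F1 -> G},
  (forall k, eta (i2 k) = j (submod_val h k)) /\ (forall v, r (eta v) = submod_val h' (q v)).
apply: (quot_rel_iso (r := rel) pq pq').
- move=> a h1 h2 h1' h2' [D1 [D1E D1E']] [D2 [D2E D2E']].
  have [D DE] := lin_combination a D1 D2; exists D; split=> [k|v]; rewrite DE.
    by rewrite D1E D2E homD homZ linearP.
  by rewrite linearP D1E' D2E'.
- move=> h; have [l lE] := hom_linear h.
  have [eta etaE] := injG _ _ i2 (j \o l) (injfP ii2).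
  have [|h' hE'] := linear_lift_surj (f := r \o eta) qs.
    by move=> v /qk[k <-]; rewrite /= etaE; apply/rk; exists (l k).
  have [h'' hE''] := hom_of_linear h'.
  by exists h'', eta; split=> [k|v]; rewrite ?etaE /= ?lE // hE'' hE'.
- move=> h'; have [l lE] := hom_linear h'.
  have [eta etaE] := pF1 _ _ r (l \o q) rs.
  have [|h hE] := linear_lift_inj (f := eta \o i2) ij.
    by move=> k; apply/rk; rewrite etaE /= (qk _).2 ?linear0 //; exists k.
  have [h'' hE''] := hom_of_linear h.
  by exists h'', eta; split=> [k|v]; rewrite ?etaE /= ?lE // hE'' hE.
- move=> h h' [eta [etaE etaE']]; split=> [[phi phiE]|[psi psiE]].
    have [eta' etaE2] := lin_combination (-1) (j \o phi) eta.
    have [|theta thetaE] := linear_lift_surj (f := eta') qs.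
      by move=> v /qk[k <-]; rewrite etaE2 etaE /= -phiE scaleN1r addNr.
    have [Theta ThetaE] := injG _ _ i1 theta (injfP ii1).
    exists (r \o Theta) => k; have [v <-] := qs k.
    rewrite /= ThetaE thetaE etaE2 linearD linearZ /= (rk _).2; last by exists (phi v).
    by rewrite scaler0 add0r etaE'.
  have [Psi PsiE] := pF0 _ _ r psi rs.
  have [eta' etaE2] := lin_combination (-1) ((Psi \o i1) \o q) eta.
  have [|mu muE] := linear_lift_inj (f := eta') ij.
    by move=> v; apply/rk; rewrite etaE2 linearD linearZ /= PsiE etaE' psiE scaleN1r addNr.
  exists mu => k; apply: (injfP ij).
  rewrite muE etaE2 /= (qk _).2 ?linear0 ?scaler0 ?add0r ?etaE //.
  by exists k.
Qed.

End Ext1.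

(** * Minimal resolutions *)

Section MinimalResolution.
Variables (R : comNzRingType) (m : submodClosed R^o) (s : R) (e : nat).
Hypothesis sg : short_gorenstein m s e.
Implicit Types U V W X Z K L N Y : lmodType R.

Local Notation msub := (msub m).
Local Notation soc := (@soc R m _).
Local Notation msq0 := (msq0 m).
Local Notation mfree := (mfree m).
Local Notation sfree := (sfree s).

Definition fmod := {X : lmodType R | finlen (@full R X)}.

Record cover (X : fmod) := Cover {
  cov_rank : nat;
  cov_syz : fmod;
  cov_i : {linear sval cov_syz -> 'rV[R]_cov_rank};
  cov_p : {linear 'rV[R]_cov_rank -> sval X};
  cov_ses : ses cov_i cov_p;
  cov_min : forall k, mfree (cov_i k) }.

Lemma finlen_inj_full U V (f : {linear U -> V}) : injf f -> finlen (@full R V) -> finlen (@full R U).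
Proof.
move=> fi fV; apply: (finlen_inj (f := f)) => // [u _|]; first exact: fi.
by have [] := len_sub (S := imsub f (@full R U)) _ fV.
Qed.

Lemma finlen_surj_full U V (f : {linear U -> V}) : surjf f -> finlen (@full R U) -> finlen (@full R V).
Proof. by move=> fs fU; rewrite -(imsub_full fs); apply: finlen_im. Qed.

(** A basis of X/m X is lifted: Nakayama gives surjectivity, and independence modulo m forces the
    relations into m F. *)
Lemma cover_exists (X : fmod) : inhabited (cover X).
Proof.
case: X => X fX; have sm := issub_msub m (@full R X).
have [Q [t [ts tk]]] := quot_exists sm.
have fQ := finlen_surj_full ts fX.
have socQ (q : Q) : full q -> soc q.
  move=> _ a am; have [x <-] := ts q; rewrite -linearZ; apply/tk.
  exact: msub_gen.
have [d [_ dg di]] := basis_exists (sg_unit sg) (issub_full Q) fQ socQ.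
have /choice[x xP] : forall j, exists x, t x = d j by move=> j; apply: ts.
have tx w : t (comb x w) = comb d w.
  by rewrite linear_comb; apply: eq_bigr => j _; rewrite xP.
have xs : surjf (comb x).
  have sI := issub_im (comb x) (issub_full 'rV[R]_(len (@full R Q))).
  suff H : forall v, imsub (comb x) (@full _ _) v by move=> v; have [w [_ <-]] := H v; exists w.
  apply: (nakayama (sg_m3 sg) sI) => v; have [w tw] := dg (t v) I.
  exists (comb x w); split; first by exists w.
  by apply/tk; rewrite linearB tx tw subrr.
have sk := issub_ker (comb x) (issub_full 'rV[R]_(len (@full R Q))).
have [K [i [ii iE]]] := sub_exists sk.
have fK : finlen (@full R K) by apply: (finlen_inj_full ii); apply: (finlen_free sg).
have ix k : comb x (i k) = 0 by have [_ /(_ (ex_intro _ k erefl))[]] := iE (i k).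
split; apply: (@Cover (exist _ X fX) _ (exist _ K fK) i (comb x)).
  by split=> // v; split=> [v0|[k <-]]; [apply/iE|apply: ix].
by move=> k; apply: di; rewrite -tx ix linear0.
Qed.

(** Injective hulls can be taken free because R is self-injective; essentiality is expressed by the
    image containing the socle s F. *)
Record hull (N : fmod) := Hull {
  hull_rank : nat;
  hull_cosyz : fmod;
  hull_i : {linear sval N -> 'rV[R]_hull_rank};
  hull_p : {linear 'rV[R]_hull_rank -> sval hull_cosyz};
  hull_ses : ses hull_i hull_p;
  hull_soc : forall w, exists n, hull_i n = s *: w }.

Lemma hull_exists (N : fmod) : inhabited (hull N).
Proof.
case: N => N fN; have [fs _] := len_sub (S := soc) (fun _ _ => I) fN.
have [f [fi fsoc]] := embedding sg (issub_soc m N) fs (fun v sv => sv).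
have finj : injf f.
  move=> n fn; apply: contrapT => n0.
  have [r [rn0 rns]] := essential_multiple (sg_m3 sg) (issub_zero N) n0.
  by apply/rn0/fi => //; rewrite linearZ fn; apply: scaler0.
have [L [p [ps pk]]] := quot_exists (issub_im f (issub_full N)).
have fL : finlen (@full R L) by apply: (finlen_surj_full ps); apply: (finlen_free sg).
split; apply: (@Hull (exist _ N fN) _ (exist _ L fL) f p).
  split=> // v; rewrite pk; split=> [[n [_ <-]]|[n <-]]; by exists n.
by move=> w; have [n [_ <-]] := fsoc w; exists n.
Qed.

Definition a_cover (X : fmod) : cover X := inhabited_witness (cover_exists X).
Definition a_hull (N : fmod) : hull N := inhabited_witness (hull_exists N).

Fixpoint syz (X : fmod) n : fmod := if n is p.+1 then cov_syz (a_cover (syz X p)) else X.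
Fixpoint cosyz (N : fmod) n : fmod := if n is p.+1 then hull_cosyz (a_hull (cosyz N p)) else N.

Definition syz_i (X : fmod) n : {linear sval (syz X n.+1) -> 'rV[R]_(cov_rank (a_cover (syz X n)))} :=
  cov_i (a_cover (syz X n)).
Definition betti (X : fmod) n := cov_rank (a_cover (syz X n)).

Lemma len_mfull_le V (S : V -> Prop) : finlen (@full R V) -> finlen S /\ (len S <= len (@full R V))%N.
Proof. exact: len_sub. Qed.

Lemma wide_quot_le X q : finlen (@full R X) -> wide_quot m X q -> (q <= len (@full R X))%N.
Proof.
move=> fX [Z [f] /= [fI _ _ qI]]; apply: leq_trans qI _.
have sI : issub (imsub f (@full R X)) by apply: issub_im.
have [_ /leq_trans] := len_sub (msub_sub (m := m) sI) fI; apply.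
by rewrite [leqRHS](lenD f (issub_full X) fX) leq_addl.
Qed.

(** Going back up the resolution, a wide quotient of the n-th syzygy would produce one of X with
    bound 2^n, more than the length of X. *)
Lemma syz_not_wide (X : fmod) n : (len (@full R (sval X)) < 2 ^ n)%N -> ~ wide_quot m (sval (syz X n)) 1.
Proof.
have gen k q : wide_quot m (sval (syz X k)) q -> wide_quot m (sval X) (2 ^ k * q).
  elim: k q => [|k IHk] q /=; first by rewrite mul1n.
  move=> /(wide_quot_syzygy sg (cov_ses _) (@cov_min _ _))/IHk.
  by rewrite expnSr mulnA.
move=> lt /gen /(wide_quot_le (svalP X)).
by rewrite muln1 leqNgt lt.
Qed.

Lemma cosyz_not_wide (N : fmod) n : (len (@full R (sval N)) < 2 ^ n)%N ->
  ~ wide_sub m (sval (cosyz N n)) 1.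
Proof.
have gen k q : wide_sub m (sval (cosyz N k)) q -> wide_sub m (sval N) (2 ^ k * q).
  elim: k q => [|k IHk] q /=; first by rewrite mul1n.
  move=> /(wide_sub_syzygy sg (hull_ses _) (@hull_soc _ _))/IHk.
  by rewrite expnSr mulnA.
move=> lt /gen [I [sI fI _ _ qI]]; have [_ lI] := len_mfull_le I (svalP N).
by move: (leq_trans (leq_trans (leq_addr _ _) qI) lI); rewrite muln1 leqNgt lt.
Qed.

Lemma cosyz_msq0 (N : fmod) n : msq0 (@full R (sval (cosyz N n.+1))).
Proof.
apply: (scale_msq0 sg) => y _; have [_ ps pk] := hull_ses (a_hull (cosyz N n)).
have [w <-] := ps y; rewrite -linearZ; apply/pk; exact: hull_soc.
Qed.

(** * Betti numbers and lengths of minimal syzygies *)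

Section Betti.
Variables (X : fmod).
Local Notation lenM n := (len (@full R (sval (syz X n)))).
Local Notation lenmM n := (len (msub (@full R (sval (syz X n))))).

Lemma len_syz n : (betti X n * e.+2 = lenM n.+1 + lenM n)%N.
Proof.
have [ii ps pk] := cov_ses (a_cover (syz X n)).
rewrite -(len_free sg) (lenD (cov_p (a_cover (syz X n))) (issub_full _) (finlen_free sg _)).
rewrite (imsub_full ps); congr addn; rewrite -[RHS](len_imsub_inj (f := syz_i X n)) //.
- by apply: len_ext => v; split=> [[_ /pk[k <-]]|[k [_ kv]]]; [exists k|split=> //; apply/pk; exists k].
- exact: svalP (syz X n.+1).
- by move=> u _; apply: ii.
Qed.

(** Minimality puts the kernel of the cover inside m F, so F and m F lose the same length when
    mapped to the syzygy. *)
Lemma betti_len n : lenM n = (betti X n + lenmM n)%N.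
Proof.
have [ii ps pk] := cov_ses (a_cover (syz X n)).
have fr := finlen_free sg; set p := cov_p (a_cover (syz X n)) in ps pk.
have l1 := lenD p (issub_full _) (fr _ _).
have l2 := lenD p (issub_mfree m (betti X n)) (fr _ _).
rewrite (len_free sg) (imsub_full ps) in l1; rewrite (len_mfree sg) in l2.
have l3 : len (kersub p (@full _ _)) = len (kersub p (fun v => mfree v)).
  apply: len_ext => v; split=> [[_ /[dup] /pk[k <-]]|[]//].
  by move=> pv; split=> //; apply: cov_min.
have l4 : len (imsub p (fun v => mfree v)) = lenmM n.
  apply: len_ext => y; rewrite -(imsub_full ps) -imsub_msub.
  by split=> -[w [mw <-]]; exists w; split=> //; apply/mfree_msub.
have {}l2 : (betti X n * e.+1 = len (kersub p (@full _ _)) + lenmM n)%N.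
  by rewrite l3 -l4; apply: l2.
move: l1 l2; rewrite -/(betti X n) (mulnS _ e.+1).
move: (betti X n * e.+1)%N (len (kersub p _)) => *; lia.
Qed.

Lemma betti_rad n : ~ wide_quot m (sval (syz X n)) 1 -> lenmM n.+1 = betti X n.
Proof.
move=> nw; have ss := cov_ses (a_cover (syz X n)); have [ii _ _] := ss.
have rad := rad_syzygy sg ss (@cov_min _ _) nw.
have sm := issub_msub m (@full R (sval (syz X n.+1))).
have [fm _] := len_mfull_le (msub (@full R (sval (syz X n.+1)))) (svalP (syz X n.+1)).
rewrite -(len_imsub_inj (f := syz_i X n) sm fm) => [|k _ /ii//].
rewrite -[RHS](len_sfree sg); apply: len_ext => v; split=> [[k [mk <-]]|[w ->]].
  move: k mk; apply: msub_min; first exact/issub_pre/issub_sfree.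
  by move=> a x am _; rewrite linearZ; apply: (mfree_scale sg am (cov_min _)).
by have [k [mk kw]] := rad w; exists k.
Qed.

(** By [betti_rad] and [betti_len], the syzygies n+1 and n+2 have lengths b_(n+1) + b_n and b_(n+2)
    + b_(n+1); their sum is (e + 2) b_(n+1) by [len_syz]. *)
Lemma betti_rec n : ~ wide_quot m (sval (syz X n)) 1 -> ~ wide_quot m (sval (syz X n.+1)) 1 ->
  (betti X n + betti X n.+2 = e * betti X n.+1)%N.
Proof.
move=> n0 n1; have := betti_rad n0; have := betti_rad n1.
have := len_syz n.+1; have := betti_len n.+1; have := betti_len n.+2; lia.
Qed.

End Betti.

Lemma len_hom_free b L (D : hom_mod 'rV[R]_b L -> Prop) (T : L -> Prop) :
  issub D -> issub T -> finlen T ->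
  (forall h, D h <-> forall j, T (submod_val h (delta_mx 0 j))) ->
  finlen D /\ len D = (b * len T)%N.
Proof.
move=> sD sT fT DE.
have /choice[g gE] : forall j, exists g : {linear hom_mod 'rV[R]_b L -> L},
    forall h, g h = submod_val h (delta_mx 0 j) by move=> j; apply: hom_eval.
apply: (len_power (g := g)) => // [h /DE Dh i|t Tt|h _ h0]; first by rewrite gE.
  have [h hE] := hom_of_linear (comb t : {linear 'rV[R]_b -> L}).
  have hd i : submod_val h (delta_mx 0 i) = t i by rewrite hE; apply: comb_delta.
  by exists h; split=> [|i]; [apply/DE => i; rewrite hd|rewrite gE hd].
apply: hom_ext => w; have [l lE] := hom_linear h; rewrite -lE linear_combE.
by rewrite /comb big1 // => i _; rewrite lE -gE h0 scaler0.
Qed.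

(** A map that kills m X takes its values in soc L. Conversely a map F -> L with values in soc L
    kills m F, hence K. So Hom(X, L) is Hom(F, soc L). *)
Lemma len_hom_cover b K X L (i : {linear K -> 'rV[R]_b}) (p : {linear 'rV[R]_b -> X}) :
  ses i p -> (forall k, mfree (i k)) -> finlen (@full R L) ->
  (forall (f : {linear X -> L}) x, msub (@full R X) x -> f x = 0) ->
  (finlen (@full R (hom_mod X L)) /\ len (@full R (hom_mod X L)) = (b * len (soc : L -> Prop))%N)
  /\ (finlen (fun h : hom_mod 'rV[R]_b L => forall k, submod_val h (i k) = 0) /\
      len (fun h : hom_mod 'rV[R]_b L => forall k, submod_val h (i k) = 0) =
        (b * len (soc : L -> Prop))%N).
Proof.
move=> [ii ps pk] im fL killed.
have [fs _] := len_mfull_le (soc : L -> Prop) fL.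
have sD : issub (fun h : hom_mod 'rV[R]_b L => forall k, submod_val h (i k) = 0).
  by split=> // a h h' h0 h0' k; rewrite homD homZ h0 h0' scaler0 addr0.
have [fD lD] : finlen (fun h : hom_mod 'rV[R]_b L => forall k, submod_val h (i k) = 0) /\
      len (fun h : hom_mod 'rV[R]_b L => forall k, submod_val h (i k) = 0) =
        (b * len (soc : L -> Prop))%N.
  apply: len_hom_free => // [|h]; first exact: issub_soc.
  have [l lE] := hom_linear h; split=> [h0 j a am|hs k].
    have [|f fE] := linear_lift_surj (f := l) ps.
      by move=> v /pk[k <-]; rewrite lE h0.
    by rewrite -lE -fE -!linearZ; apply: killed; rewrite linearZ; apply: msub_gen.
  rewrite -lE linear_combE /comb big1 // => j _.
  by rewrite lE; apply: hs; apply: im.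
split=> //; rewrite -lD.
have [P PE] : exists P : {linear hom_mod X L -> hom_mod 'rV[R]_b L},
    forall h v, submod_val (P h) v = submod_val h (p v).
  by exists (hom_map L p).
have Pi : forall h, full h -> P h = 0 -> h = 0.
  move=> h _ Ph; apply: hom_ext => x; have [v <-] := ps x.
  by rewrite -PE Ph.
have imP h : imsub P (@full R _) h <-> forall k, submod_val h (i k) = 0.
  split=> [[h' [_ <-]] k|h0].
    have [l lE] := hom_linear h'.
    by rewrite PE (pk _).2 -?lE ?linear0 //; exists k.
  have [l lE] := hom_linear h; have [|f fE] := linear_lift_surj (f := l) ps.
    by move=> v /pk[k <-]; rewrite lE h0.
  have [h' hE'] := hom_of_linear f; exists h'; split=> //.
  by apply: hom_ext => v; rewrite PE hE' fE lE.
have fH : finlen (@full R (hom_mod X L)).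
  by apply: (finlen_inj (f := P)) => //; apply: finlen_ext fD => h; rewrite imP.
split=> //; rewrite -(len_imsub_inj (f := P)) //.
exact: len_ext.
Qed.

(** Lengths in 0 -> Hom(X, L) -> Hom(F, L) -> Hom(K, L) -> T -> 0: the three Hom modules have
    lengths b t, b l and b' t, where l = len L and t = len (soc L). T is killed by m because Hom(K,
    L) is. *)
Lemma ext1_len b K X b' K' L T (i : {linear K -> 'rV[R]_b}) (p : {linear 'rV[R]_b -> X})
    (i' : {linear K' -> 'rV[R]_b'}) (p' : {linear 'rV[R]_b' -> K}) :
  ses i p -> (forall k, mfree (i k)) -> ses i' p' -> (forall k, mfree (i' k)) ->
  finlen (@full R L) ->
  (forall (f : {linear X -> L}) x, msub (@full R X) x -> f x = 0) ->
  (forall (f : {linear K -> L}) x, msub (@full R K) x -> f x = 0) ->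
  is_ext1 i L T ->
  [/\ annihilated m T, finlen (@full R T)
    & (len (@full R T) + b * len (@full R L) = (b' + b) * len (soc : L -> Prop))%N].
Proof.
move=> ss im ss' im' fL kX kK [q [qs qk]].
have [_ [fD lD]] := len_hom_cover ss im fL kX.
have [[fH lH] _] := len_hom_cover ss' im' fL kK.
split.
- move=> a t am; have [h <-] := qs t; rewrite -linearZ.
  rewrite (_ : a *: h = 0) ?linear0 //; apply: hom_ext => k.
  have [l lE] := hom_linear h; rewrite homZ -lE -linearZ kK ?hom0 //.
  exact: msub_gen.
- exact: finlen_surj_full qs fH.
have [fF lF] : finlen (@full R (hom_mod 'rV[R]_b L)) /\
    len (@full R (hom_mod 'rV[R]_b L)) = (b * len (@full R L))%N.
  by apply: len_hom_free.
have [P PE] : exists P : {linear hom_mod 'rV[R]_b L -> hom_mod K L},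
    forall h v, submod_val (P h) v = submod_val h (i v).
  by exists (hom_map L i).
have l1 := lenD P (issub_full _) fF; have l2 := lenD q (issub_full _) fH.
have l3 : len (kersub P (@full R _)) = (b * len (soc : L -> Prop))%N.
  rewrite -lD; apply: len_ext => h; split=> [[_ Ph] k|h0]; first by rewrite -PE Ph.
  by split=> //; apply: hom_ext => k; rewrite PE h0.
have l4 : len (kersub q (@full R _)) = len (imsub P (@full R _)).
  apply: len_ext => h; split=> [[_ /qk[g gE]]|[h' [_ <-]]].
    have [h' hE'] := hom_of_linear g; exists h'; split=> //.
    by apply: hom_ext => k; rewrite PE hE' gE.
  split=> //; apply/qk; have [l lE] := hom_linear h'; exists l => k.
  by rewrite PE lE.
move: l1 l2; rewrite (imsub_full qs) l3 l4 lF lH; lia.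
Qed.

End MinimalResolution.

(** * Arbitrary projective resolutions *)

Section ProjectiveResolution.
Variables (R : comNzRingType) (M : lmodType R) (P : proj_resolution M).
Implicit Types N K F X T U V : lmodType R.

Definition res_syz n : lmodType R :=
  match n with
  | 0 => M
  | 1 => ker_mod (pr_aug P)
  | j.+2 => ker_mod (pr_d P j)
  end.

Definition res_i n : {linear res_syz n.+1 -> P n} :=
  match n with
  | 0 => (val : {linear ker_mod (pr_aug P) -> P 0%N})
  | j.+1 => (val : {linear ker_mod (pr_d P j) -> P j.+1})
  end.

Lemma res_i_inj n : injf (res_i n).
Proof. by case: n => [|n] u u0; apply: val_inj. Qed.

Lemma ker_modE U V (g : {linear U -> V}) v :
  g v = 0 <-> exists k : ker_mod g, val k = v.
Proof.
split=> [gv|[k <-]]; last exact/eqP/(valP k).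
have kv : v \in ker_pred g by apply/eqP.
by exists (Submod kv).
Qed.

Lemma res_ses0 : ses (res_i 0) (pr_aug P).
Proof.
split; [exact: res_i_inj|exact: pr_surj|].
by move=> v; exact: ker_modE.
Qed.

Lemma res_sesS n : exists q : {linear P n.+1 -> res_syz n.+1},
  ses (res_i n.+1) q /\ forall x, res_i n (q x) = pr_d P n x.
Proof.
have im v : (exists u, pr_d P n u = v) <-> exists k, res_i n k = v.
  case: n v => [|n] v; first by rewrite -[X in _ <-> X]ker_modE; symmetry; apply: pr_exact0.
  by rewrite -[X in _ <-> X]ker_modE; symmetry; apply: pr_exact.
have [|q qE] := linear_lift_inj (f := pr_d P n) (@res_i_inj n).
  by move=> x; apply/im; exists x.
exists q; split=> //; split; first exact: res_i_inj.
  move=> k; have [u uk] : exists u, pr_d P n u = res_i n k by apply/im; exists k.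
  by exists u; apply: (injfP (@res_i_inj n)); rewrite qE.
move=> v; rewrite -[X in _ <-> X]ker_modE -qE; split=> [->|/res_i_inj//].
exact: linear0.
Qed.

(** A cocycle on P (n+1) factors through the syzygy below it, and it is a coboundary exactly when
    that factor extends to P n. *)
Lemma is_ext1_Ext n N : is_ext1 (res_i n) N (Ext P N n.+1).
Proof.
have [q [[_ qs qk] qE]] := res_sesS n.
pose Z := ker_mod (hom_map N (pr_d P n.+1)).
have dq x : q x = 0 <-> exists u, pr_d P n.+1 u = x.
  rewrite -[X in _ <-> X](@pr_exact _ _ P n x) -qE; split=> [->|/res_i_inj//].
  exact: linear0.
have [||A AE] := @linear_lift_inj R (hom_mod (res_syz n.+1) N) Z (hom_mod (P n.+1) N)
  (val : {linear Z -> hom_mod (P n.+1) N}) (hom_map N q).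
- by move=> u u0; apply: val_inj.
- move=> h; apply/ker_modE/hom_ext => x; have [l lE] := hom_linear h.
  have -> : submod_val (hom_map N (pr_d P n.+1) (hom_map N q h)) x = l (q (pr_d P n.+1 x)) by rewrite lE.
  by rewrite (dq _).2 ?linear0 //; exists x.
have AE' h x : submod_val (val (A h)) x = submod_val h (q x) by rewrite AE.
pose B := @bnd_pred R _ _ _ (hom_map N (pr_d P n)) (hom_map N (pr_d P n.+1)).
exists (to_quot B \o A); split.
  move=> t; pose z := quot_repr t; have [l lE] := hom_linear (val z).
  have zE : to_quot B z = t by apply: to_quotK.
  have [|f fE] := linear_lift_surj (f := l) qs.
    move=> v /dq[u <-]; rewrite lE.
    have /ker_modE : exists k : Z, val k = val z by exists z.
    by move/(congr1 (fun h => submod_val h u)).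
  have [h hE] := hom_of_linear f; exists h; rewrite -zE /=; congr (to_quot _ _).
  by apply/val_inj/hom_ext => x; rewrite AE' hE fE lE.
move=> h; have -> : (to_quot B \o A) h = 0 <-> A h \in B.
  have -> : (A h \in B) = (A h - 0 \in B) by rewrite subr0.
  by rewrite -to_quot_eq (linear0 (to_quot B)).
split=> [/asboolP[g gE]|[g gE]].
  have [l lE] := hom_linear g; exists l => k; have [v <-] := qs k.
  by rewrite qE -AE' -gE lE.
apply/asboolP; have [g' gE'] := hom_of_linear g; exists g'.
by apply: hom_ext => x; rewrite AE' gE -gE' qE.
Qed.

End ProjectiveResolution.

(** * Ext in high degrees *)

Lemma eventually_shift (Q : nat -> Prop) n0 j :
  (forall n, (n0 <= n)%N -> Q (n + j).+1) -> exists i0, forall i, (i0 <= i)%N -> Q i.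
Proof.
move=> QS; exists (n0 + j).+1 => -[//|i]; rewrite ltnS => n0i.
have ji : (j <= i)%N by apply: leq_trans n0i; apply: leq_addl.
by rewrite -(subnK ji); apply: QS; rewrite leq_subRL // addnC.
Qed.

(** Each x_i is (b_(i+1) + b_i) t - b_i l, a fixed combination of a sequence satisfying the
    recurrence. The additive form avoids truncated subtraction; the term to cancel is e b1 l. *)
Lemma ext_length_rec (e b0 b1 b2 b3 x0 x1 x2 l t : nat) :
  (b0 + b2 = e * b1)%N -> (b1 + b3 = e * b2)%N -> (x0 + b0 * l = (b1 + b0) * t)%N ->
  (x1 + b1 * l = (b2 + b1) * t)%N -> (x2 + b2 * l = (b3 + b2) * t)%N ->
  (x0 + x2 = e * x1)%N.
Proof.
move=> r0 r1 l0 l1 l2; apply: (@addIn (e * b1 * l)%N).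
transitivity ((x0 + b0 * l) + (x2 + b2 * l))%N; first by rewrite -r0; ring.
transitivity ((b1 + b3) * t + (b0 + b2) * t)%N; first by rewrite l0 l2; ring.
transitivity (e * (x1 + b1 * l))%N; last by ring.
by rewrite r0 r1 l1; ring.
Qed.

(** * Stable equivalence and comparison of resolutions *)

Section Comparison.
Variable R : comNzRingType.
Implicit Types N K F X T U V : lmodType R.

Definition stab_equiv X X' := exists (f : {linear X -> X'}) (g : {linear X' -> X}),
  proj_factor (fun x => x - g (f x)) /\ proj_factor (fun x => x - f (g x)).

Lemma stab_refl X : stab_equiv X X.
Proof.
suff pf : proj_factor (fun x : X => x - x) by exists idfun, idfun.
have [a aE] := linear_zero X 'rV[R]_0; have [b bE] := linear_zero 'rV[R]_0 X.
exists 'rV[R]_0, a, b; split=> [|x]; first exact: rV_projective.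
by rewrite bE subrr.
Qed.

(** A form of Schanuel's lemma: by [ses_homotopy] the composites differ from the identities of K and
    K' by maps through F and F'. The same homotopies identify the two Ext^1. *)
Lemma stab_step K F X K' F' X' (i : {linear K -> F}) (p : {linear F -> X})
    (i' : {linear K' -> F'}) (p' : {linear F' -> X'}) :
  ses i p -> ses i' p' -> projective F -> projective F' -> stab_equiv X X' ->
  stab_equiv K K' /\
  forall N T T', is_ext1 i N T -> is_ext1 i' N T' -> iso_mod T T'.
Proof.
move=> ss ss' pF pF' [f [g [fg gf]]].
have [f0 [f1 [f0E f1E]]] := ses_lift f ss ss' pF.
have [g0 [g1 [g0E g1E]]] := ses_lift g ss' ss pF'.
have [u uE] := ses_homotopy ss f0E f1E g0E g1E fg.
have [u' uE'] := ses_homotopy ss' g0E g1E f0E f1E gf.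
split; last by move=> N T T'; apply: is_ext1_iso f1E g1E uE uE'.
by exists f1, g1; split; [exists F, i, u|exists F', i', u'].
Qed.

End Comparison.

Section ExtTheorem.
Variables (R : comNzRingType) (m : submodClosed R^o) (s : R) (e : nat).
Hypothesis sg : short_gorenstein m s e.
Implicit Types N K F X T U V : lmodType R.

Lemma res_stab (X : fmod R) (P : proj_resolution (sval X)) n :
  stab_equiv (res_syz P n) (sval (syz sg X n)).
Proof.
elim: n => [|n IHn]; first exact: stab_refl.
have [p ss] : exists p : {linear P n -> res_syz P n}, ses (res_i P n) p.
  case: n {IHn} => [|n]; first by exists (pr_aug P); apply: res_ses0.
  by have [q [ss _]] := res_sesS P n; exists q.
have [] // := stab_step ss (cov_ses (a_cover sg (syz sg X n))) _ _ IHn.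
  exact: pr_proj.
exact: rV_projective.
Qed.

Lemma Ext_syz (X : fmod R) (P : proj_resolution (sval X)) n N T :
  is_ext1 (syz_i sg X n) N T -> iso_mod (Ext P N n.+1) T.
Proof.
have [p ss] : exists p : {linear P n -> res_syz P n}, ses (res_i P n) p.
  case: n => [|n]; first by exists (pr_aug P); apply: res_ses0.
  by have [q [ss _]] := res_sesS P n; exists q.
have [||_] := stab_step ss (cov_ses (a_cover sg (syz sg X n))) _ _ (res_stab P n).
- exact: pr_proj.
- exact: rV_projective.
by apply; apply: is_ext1_Ext.
Qed.

(** One syzygy of X is traded for one cosyzygy of N at each step. For j = 0, [T] and [T'] are two
    models of the same Ext^1. *)
Lemma syz_shift (X N : fmod R) j n T T' :
  is_ext1 (syz_i sg X (n + j)) (sval N) T ->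
  is_ext1 (syz_i sg X n) (sval (cosyz sg N j)) T' -> iso_mod T T'.
Proof.
elim: j n T' => [|j IHj] n T'.
  rewrite addn0 => TE TE'; have [_] := stab_step (cov_ses (a_cover sg (syz sg X n)))
    (cov_ses (a_cover sg (syz sg X n))) (@rV_projective _ _) (@rV_projective _ _) (stab_refl _).
  by apply; [exact: TE|exact: TE'].
rewrite -addSnnS => TE TE'.
have [T2 T2E] := ext1_exists (syz_i sg X n.+1) (sval (cosyz sg N j)).
apply: iso_trans (IHj _ _ TE T2E) _.
apply: (is_ext1_shift (cov_ses (a_cover sg (syz sg X n.+1)))
  (cov_ses (a_cover sg (syz sg X n))) (hull_ses (a_hull sg (cosyz sg N j)))) T2E TE'.
- exact: rV_projective.
- exact: rV_projective.
- exact: rV_injective (sg_inj sg).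
Qed.

Lemma iso_annihilated T T' : iso_mod T T' -> annihilated m T' -> annihilated m T.
Proof. by move=> [f [fi _]] annT a x am; apply: fi; rewrite linearZ; apply: annT. Qed.

Lemma Ext_eventually M (P : proj_resolution M) N :
  finlen (@full R M) -> finlen (@full R N) ->
  exists i0, forall i, (i0 <= i)%N ->
  [/\ annihilated m (Ext P N i), finlen (@full R (Ext P N i))
    & (len (@full R (Ext P N i)) + len (@full R (Ext P N i.+2))
       = e * len (@full R (Ext P N i.+1)))%N].
Proof.
move=> fM fN; pose X : fmod R := exist _ M fM; pose N' : fmod R := exist _ N fN.
(* Both choices exceed the thresholds because k < 2^k; the successor in [j] makes L an actual
   cosyzygy, so that m^2 L = 0. *)
pose n0 := len (@full R M); pose j := (len (@full R N)).+1.
pose L := sval (cosyz sg N' j).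
pose l := len (@full R L); pose t := len (@soc R m L).
have nX n : (n0 <= n)%N -> ~ wide_quot m (sval (syz sg X n)) 1.
  by move=> n0n; apply: syz_not_wide; apply: leq_ltn_trans n0n (ltn_expl _ _).
have nL : ~ wide_sub m L 1 by apply: cosyz_not_wide; apply: leq_ltn_trans (leqnSn _) (ltn_expl _ _).
have killed n : (n0 <= n)%N -> forall (f : {linear sval (syz sg X n) -> L}) x,
    msub m (@full R _) x -> f x = 0.
  move=> n0n; apply: radical_killed => //; [exact: nX|exact: cosyz_msq0|].
  exact: svalP (cosyz sg N' j).
have ExtE n : (n0 <= n)%N ->
  [/\ annihilated m (Ext P N (n + j).+1), finlen (@full R (Ext P N (n + j).+1))
    & (len (@full R (Ext P N (n + j).+1)) + betti sg X n * l
       = (betti sg X n.+1 + betti sg X n) * t)%N].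
  move=> n0n; have [T TE] := ext1_exists (syz_i sg X n) L.
  have [T' TE'] := ext1_exists (syz_i sg X (n + j)) N.
  have [annT fT lT] : [/\ annihilated m T, finlen (@full R T)
    & (len (@full R T) + betti sg X n * l = (betti sg X n.+1 + betti sg X n) * t)%N].
    apply: (ext1_len (cov_ses (a_cover sg (syz sg X n))) _
      (cov_ses (a_cover sg (syz sg X n.+1))) _ _ _ _ TE).
    - exact: cov_min.
    - exact: cov_min.
    - exact: svalP (cosyz sg N' j).
    - exact: killed.
    - exact: (killed n.+1 (leqW n0n)).
  have iso : iso_mod (Ext P N (n + j).+1) T.
    apply: (iso_trans (@Ext_syz X P _ _ _ TE')).
    exact: (syz_shift (N := N') TE' TE).
  have [fE lE] := iso_len (iso_sym iso) fT.
  by split=> //; [apply: iso_annihilated iso annT|rewrite lE].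
apply: (@eventually_shift _ n0 j) => n jn.
have [annE fE l0] := ExtE n jn; have [_ _ l1] := ExtE n.+1 (leqW jn).
have [_ _ l2] := ExtE n.+2 (leqW (leqW jn)).
split=> //; move: l0 l1 l2; rewrite !addSn.
have r0 := betti_rec (nX _ jn) (nX _ (leqW jn)).
have r1 := betti_rec (nX _ (leqW jn)) (nX _ (leqW (leqW jn))).
move: r0 r1; move: (betti sg X n) (betti sg X n.+1) (betti sg X n.+2) (betti sg X n.+3).
move: (len _) (len _) (len _) => x0 x1 x2 b0 b1 b2 b3 r0 r1 l0 l1 l2.
exact: (ext_length_rec r0 r1 l0 l1 l2).
Qed.

End ExtTheorem.

(** * Tensor products and duality *)

Section TensorLift.
Import freeg.
Variable R : comNzRingType.
Implicit Types M N V : lmodType R.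

Lemma tensor_lift M N V (b : M -> N -> V) :
  (forall x x' y, b (x + x') y = b x y + b x' y) ->
  (forall x y y', b x (y + y') = b x y + b x y') ->
  (forall a x y, b (a *: x) y = a *: b x y) ->
  (forall a x y, b x (a *: y) = a *: b x y) ->
  exists phi : {linear tensor M N -> V}, forall x y, phi (tensor_pure x y) = b x y.
Proof.
move=> bDl bDr bZl bZr.
pose f : {linear {freeg (M * N)%type / R} -> V} := free_lift (fun xy : M * N => b xy.1 xy.2).
have fE x y : f << (x, y) >> = b x y by rewrite /f /= free_liftE.
have fspan D : D \in span (@tensor_rel R M N) -> f D = 0.
  move=> Dspan; have := span_min (A := @tensor_rel R M N) (issub_ker f (issub_full _)) _ Dspan.
  case=> // {Dspan}D rD; split=> //.
  case: rD => [x x' y|x y y'|a x y|a x y]; rewrite !linearB /= ?linearZ_LR !fE.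
  - by rewrite bDl addrAC addrK subrr.
  - by rewrite bDr addrAC addrK subrr.
  - by rewrite bZl [a *: _ (b x y)]scalerN subrr.
  - by rewrite bZr [a *: _ (b x y)]scalerN subrr.
pose q : {linear {freeg (M * N)%type / R} -> tensor M N} := to_quot (span (@tensor_rel R M N)).
have [t|D qD|phi phiE] := linear_lift_surj (p := q) (f := f).
- by exists (quot_repr t); apply: to_quotK.
- apply: fspan; rewrite -[D]subr0; apply/to_quot_eq; rewrite -/(q D) qD.
  exact: (esym (linear0 q)).
by exists phi => x y; rewrite -fE -phiE.
Qed.

Lemma tensor_ext M N V (f g : {linear tensor M N -> V}) :
  (forall x y, f (tensor_pure x y) = g (tensor_pure x y)) -> forall t, f t = g t.
Proof.
move=> fg t; rewrite -[t]to_quotK; move: (quot_repr t) => D.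
pose q : {linear {freeg (M * N)%type / R} -> tensor M N} := to_quot (span (@tensor_rel R M N)).
apply: (@free_linear_ext _ _ _ (f \o q) (g \o q)) => -[x y].
exact: fg.
Qed.

End TensorLift.

Section TorDual.
Variable R : comNzRingType.
Hypothesis injR : injective_mod (R^o : lmodType R).

Local Notation dual V := (hom_mod V (R^o : lmodType R)).

Definition is_homology (U V W : lmodType R) (f : {linear U -> V}) (g : {linear V -> W}) (H : lmodType R) :=
  exists (Z : lmodType R) (i : {linear Z -> V}) (p : {linear Z -> H}),
  [/\ injf i, forall v, g v = 0 <-> exists z, i z = v, surjf p
    & forall z, p z = 0 <-> exists u, f u = i z].

Lemma homologyP (U V W : lmodType R) (f : {linear U -> V}) (g : {linear V -> W}) :
  is_homology f g (homology f g).
Proof.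
pose B := @bnd_pred R _ _ _ f g.
exists (ker_mod g), (val : {linear ker_mod g -> V}), (to_quot B); split.
- by move=> z z0; apply: val_inj.
- by move=> v; apply: ker_modE.
- by move=> t; exists (quot_repr t); apply: to_quotK.
move=> z; have -> : (exists u, f u = val z) <-> z - 0 \in B.
  by rewrite subr0; split=> [H|/asboolP//]; apply/asboolP.
by rewrite -to_quot_eq (linear0 (to_quot B)).
Qed.

Lemma bilinear_dual (U N : lmodType R) (h : hom_mod U (dual N)) :
  exists tau : {linear tensor U N -> R^o},
    forall x y, tau (tensor_pure x y) = submod_val (submod_val h x) y.
Proof.
have [l lE] := hom_linear h.
apply: (@tensor_lift R U N (R^o : lmodType R) (fun x y => submod_val (submod_val h x) y)).
- by move=> x x' y; rewrite -!lE linearD.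
- by move=> x y y'; have [k kE] := hom_linear (submod_val h x); rewrite -!kE linearD.
- by move=> a x y; rewrite -!lE linearZ.
- by move=> a x y; have [k kE] := hom_linear (submod_val h x); rewrite -!kE linearZ.
Qed.

Lemma dual_bilinear (U N : lmodType R) (tau : {linear tensor U N -> R^o}) :
  exists h : hom_mod U (dual N),
    forall x y, submod_val (submod_val h x) y = tau (tensor_pure x y).
Proof.
have /choice[h hE] : forall x, exists h : dual N, forall y, submod_val h y = tau (tensor_pure x y).
  move=> x; have [k kE] : exists k : {linear N -> R^o}, forall y, k y = tau (tensor_pure x y).
    by apply: linear_exists => a y y'; rewrite tensor_pureDr tensor_pureZr linearP.
  by have [h hE] := hom_of_linear k; exists h => y; rewrite hE kE.
have lh : linear h.
  move=> a x x'; apply: hom_ext => y.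
  by rewrite homD homZ !hE tensor_pureDl tensor_pureZl linearP.
have [h' hE'] := linear_exists lh; have [g gE] := hom_of_linear h'.
by exists g => x y; rewrite gE hE' hE.
Qed.

Lemma hom2P (U N : lmodType R) a (h h' : hom_mod U (dual N)) x y :
  submod_val (submod_val (a *: h + h') x) y =
  a *: submod_val (submod_val h x) y + submod_val (submod_val h' x) y.
Proof. by rewrite homD homZ. Qed.

(** By tensor-hom adjunction Hom(P, Hom(N, R)) is the dual of P (x) N, and duality commutes with
    homology because R is injective. A cocycle corresponds to a functional on T when one [tau] on P1
    (x) N induces both. *)
Lemma homology_dual (P2 P1 P0 N T E : lmodType R) (d1 : {linear P2 -> P1})
    (d0 : {linear P1 -> P0}) :
  (forall x, d0 (d1 x) = 0) ->
  is_homology (tensor_map N d1) (tensor_map N d0) T ->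
  is_homology (hom_map (dual N) d0) (hom_map (dual N) d1) E ->
  iso_mod E (dual T).
Proof.
move=> dd [Z [i [pT [ii iE pTs pTk]]]] [C [j [pE [ji jE pEs pEk]]]].
pose rel (z : C) (d : dual T) := exists tau : {linear tensor P1 N -> R^o},
    (forall x y, tau (tensor_pure x y) = submod_val (submod_val (j z) x) y) /\
    forall w : Z, submod_val d (pT w) = tau (i w).
have tE x y : tensor_map N d1 (tensor_pure x y) = tensor_pure (d1 x) y by exact: tensor_mapE.
have tE0 x y : tensor_map N d0 (tensor_pure x y) = tensor_pure (d0 x) y by exact: tensor_mapE.
have qE : quot_of (fun z : C => pE z = 0) pE by [].
have qD : quot_of (fun d : dual T => d = 0) (idfun : {linear dual T -> dual T}).
  by split=> // d; exists d.
apply: (quot_rel_iso (r := rel) qE qD).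
- move=> a z z' d d' [t1 [t1E t1E']] [t2 [t2E t2E']].
  have [t ttE] := lin_combination a t1 t2; exists t; split=> [x y|w]; rewrite ttE.
    have jz : j (a *: z + z') = a *: j z + j z' by apply: linearP.
    by rewrite jz hom2P t1E t2E.
  by rewrite homD homZ t1E' t2E'.
- move=> z; have [tau tauE] := bilinear_dual (j z).
  have tau0 u : tau (tensor_map N d1 u) = 0.
    have [zero zeroE] := linear_zero (tensor P2 N) R^o.
    rewrite -(zeroE u); apply: (@tensor_ext R _ N _ (tau \o tensor_map N d1) zero) => x y.
    rewrite zeroE /= tE tauE; have /jE : exists k, j k = j z by exists z.
    by move/(congr1 (fun h => submod_val (submod_val h x) y)).
  have [|d dE] := linear_lift_surj (f := tau \o i) pTs.
    by move=> w /pTk[u /= <-]; rewrite tau0.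
  have [d' dE'] := hom_of_linear d.
  by exists d', tau; split=> // w; rewrite dE' dE.
- move=> d; have [l lE] := hom_linear d.
  have [tau tauE] := injR (l \o pT) (injfP ii).
  have [g gE] := dual_bilinear tau.
  have [z zE] : exists z, j z = g.
    apply/jE/hom_ext => x; apply: hom_ext => y.
    have -> : submod_val (submod_val (hom_map (dual N) d1 g) x) y = tau (tensor_map N d1 (tensor_pure x y)).
      by rewrite tE -gE.
    have du : tensor_map N d0 (tensor_map N d1 (tensor_pure x y)) = 0.
      by rewrite tE tE0 dd -(scale0r (0 : P0)) tensor_pureZl scale0r.
    have [w wE] := (iE _).1 du.
    have pw0 : pT w = 0 by apply/pTk; exists (tensor_pure x y); rewrite wE.
    by rewrite -wE tauE /= pw0 linear0.
  exists z, tau; split=> [x y|w]; first by rewrite zE gE.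
  by rewrite tauE /= lE.
- move=> z d [tau [tauE tauE']]; split=> [/pEk[g gE]|d0'].
    have [sig sigE] := bilinear_dual g.
    have sigtau : forall t, tau t = (sig \o tensor_map N d0) t.
      by apply: tensor_ext => x y; rewrite tauE -gE /= tE0 sigE.
    apply: hom_ext => t; have [w <-] := pTs t; rewrite tauE' sigtau /=.
    have -> : tensor_map N d0 (i w) = 0 by apply/iE; exists w.
    by rewrite linear0.
  (* When [d = 0], [tau] vanishes on the kernel of d0 (x) N, so injectivity of R factors it through
     d0 (x) N. *)
  have [w /iE[w' <-]|sig sigE] := injective_ext (h := tensor_map N d0) (f := tau) injR.
    by rewrite -tauE' d0'.
  have [g gE] := dual_bilinear sig.
  apply/pEk; exists g; apply: hom_ext => x; apply: hom_ext => y.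
  have e : sig (tensor_pure (d0 x) y) = tau (tensor_pure x y).
    exact: (etrans (esym (congr1 sig (tE0 x y))) (sigE _)).
  by rewrite -[RHS]tauE -e -gE.
Qed.

Lemma Tor_dual (M N : lmodType R) (P : proj_resolution M) n :
  iso_mod (Ext P (dual N) n.+1) (dual (Tor P N n.+1)).
Proof.
apply: (@homology_dual _ _ _ N _ _ (pr_d P n.+1) (pr_d P n)).
- by move=> x; apply/pr_exact; exists x.
- exact: homologyP.
- exact: homologyP.
Qed.

End TorDual.

(** * Minimal numbers of generators and lengths *)

Section ResidueRank.
Variables (R : comNzRingType) (m : submodClosed R^o).
Implicit Types V Q L : lmodType R.
Hypothesis m_unit : forall u : R, u \notin m -> exists v : R, v * u = 1.

Lemma len_simple V (S : V -> Prop) x : issub S -> S x -> x <> 0 ->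
  (forall v, S v -> v <> 0 -> forall w, S w -> exists r : R, w = r *: v) ->
  finlen S /\ len S = 1%N.
Proof.
move=> sS Sx x0 simple; apply: len_unique.
  exists (fun v => v = 0); split=> //; first exact: issub_zero.
  - by move=> _ ->; apply: issub0.
  - by exists x.
move=> [T [sT TS [v [Sv Tv]] [T' [sT' T'T [w [Tw T'w]] _]]]].
have w0 : w <> 0 by move=> w0; apply: T'w; rewrite w0; apply: issub0.
by have [r vE] := simple w (TS _ Tw) w0 v Sv; apply: Tv; rewrite vE; apply: issubZ.
Qed.

Lemma finlen_generated n V (x : 'I_n -> V) : (forall v : V, soc m v) ->
  (forall v, exists w, v = comb x w) -> finlen (@full R V).
Proof.
elim: n V x => [|n IHn] V x socV gen.
  have [|//] := @len0 R V (@full R V).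
  by move=> v _; have [w ->] := gen v; rewrite /comb big_ord0.
pose S v := exists r : R, v = r *: x ord0.
have sS : issub S.
  split=> [|a _ _ [r ->] [t ->]]; first by exists 0; rewrite scale0r.
  by exists (a * r + t); rewrite scalerDl scalerA.
have [Q [q [qs qk]]] := quot_exists sS.
have fQ : finlen (@full R Q).
  apply: (IHn Q (fun j => q (x (lift ord0 j)))).
    by move=> y a am; have [v <-] := qs y; rewrite -linearZ socV ?linear0.
  move=> y; have [v <-] := qs y; have [w ->] := gen v.
  exists (\row_j w 0 (lift ord0 j)); rewrite linear_comb /comb big_ord_recl.
  rewrite (qk (x ord0)).2 ?scaler0 ?add0r; last by exists 1; rewrite scale1r.
  by apply: eq_bigr => i _; rewrite mxE.
have fS : finlen S.
  have [x0|x0] := pselect (x ord0 = 0).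
    by have [v [r ->]|//] := @len0 R V S; rewrite x0 scaler0.
  have [||//] := @len_simple V S (x ord0) sS _ x0; first by exists 1; rewrite scale1r.
  move=> _ [r ->] r0 _ [t ->].
  have [rm|/m_unit[u ur]] := boolP (r \in m); first by case: r0; apply: socV.
  by exists (t * u); rewrite scalerA -mulrA ur mulr1.
have [||//] := len_add (f := q) (issub_full V).
  by apply: finlen_ext fS => v; rewrite -qk; split=> [|[]].
by rewrite (imsub_full qs).
Qed.

Section FiniteLength.
Hypothesis finR : finlen (@full R R^o).
Hypothesis lenR : len (@full R R^o) = (len (fun x : R^o => x \in m)).+1.

(** The map R^n -> Q given by the basis has kernel m R^n, and n (len m + 1) - n len m = n. In
    particular all residue bases have the same size, which determines the value of [nu]. *)
Lemma residue_basis_len Q n (b : 'I_n -> Q) : (forall v : Q, soc m v) ->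
  residue_basis m b -> finlen (@full R Q) /\ len (@full R Q) = n.
Proof.
move=> socQ [bg bi].
have [fF lF] := len_coord n finR (issub_full R^o).
have [fm lm] := len_coord n finR (issub_closed m).
have bs : surjf (comb b).
  by move=> v; have [c ->] := bg v; exists (\row_i c i); apply: eq_bigr => i _; rewrite mxE.
have FE (v : 'rV[R]_n) : (forall i, full (v 0 i : R^o)) <-> full v by [].
have {}fF := finlen_ext FE fF; rewrite (len_ext FE) in lF.
have l := lenD (comb b) (issub_full _) fF.
split; first by rewrite -(imsub_full bs); apply: finlen_im.
have lk : len (kersub (comb b) (@full _ _)) = (n * len (fun x : R^o => x \in m))%N.
  rewrite -lm; apply: len_ext => v; split=> [[_ /bi vm] i //|vm]; split=> //.
  by rewrite /comb big1 // => i _; apply: socQ; apply: vm.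
by move: (etrans (esym lF) l); rewrite (imsub_full bs) lk lenR mulnS addnC => /addnI.
Qed.

End FiniteLength.

Lemma nuE L : finlen (@full R R^o) ->
  len (@full R R^o) = (len (fun x : R^o => x \in m)).+1 ->
  annihilated m L -> finlen (@full R L) -> nu m L = len (@full R L).
Proof.
move=> finR lenR annL fL; pose S := prod_submod m (@predT L).
pose Q := quot_mod S; pose p : {linear L -> Q} := to_quot S.
have S0 v : v \in S -> v = 0.
  move=> Sv; apply: (span_min (issub_zero L) _ Sv) => _ [a [x [am _ ->]]].
  exact: annL.
have iso : iso_mod L Q.
  exists p; split=> [v pv|q]; last by exists (quot_repr q); apply: to_quotK.
  apply: S0; rewrite -[v]subr0; apply/to_quot_eq.
  by rewrite -/(p v) pv; exact: (esym (linear0 p)).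
have [fQ <-] := iso_len iso fL.
have socQ (q : Q) : soc m q.
  by have [f [_ fs]] := iso; have [v <-] := fs q; move=> a am; rewrite -linearZ annL ?linear0.
have [b [_ bg bi]] := basis_exists m_unit (issub_full Q) fQ (fun v _ => socQ v).
rewrite /nu; apply: xget_unique => /=.
  exists b; split=> [v|c c0 i].
    by have [w ->] := bg v I; exists (fun i => w 0 i).
  have /bi/(_ i) : comb b (\row_i c i) = 0.
    by rewrite -[RHS]c0; apply: eq_bigr => k _; rewrite mxE.
  by rewrite mxE.
by move=> n [c /(residue_basis_len finR lenR socQ)[_ ->]].
Qed.

End ResidueRank.

(** * Tor in high degrees *)

Section DualLength.
Variables (R : comNzRingType) (m : submodClosed R^o) (s : R) (e : nat).
Hypothesis sg : short_gorenstein m s e.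

Local Notation dual V := (hom_mod V (R^o : lmodType R)).

Lemma annihilated_dual (T : lmodType R) : annihilated m (dual T) -> annihilated m T.
Proof.
move=> annD a x am; apply: contrapT => /(nonzero_functional sg)[f fax].
have [h hE] := hom_of_linear f; apply: fax.
rewrite linearZ -hE; exact: (congr1 (fun h : dual T => submod_val h x) (annD a h am)).
Qed.

(** Annihilators reverse a chain of submodules; strictness survives because functionals separate the
    points of a quotient of T. *)
Lemma lge_dual (T : lmodType R) n : lge n (@full R T) -> lge n (@full R (dual T)).
Proof.
pose perp (S : T -> Prop) (h : dual T) := forall x, S x -> submod_val h x = 0.
(* Accumulator form: the part of the chain above [S] has already become [k] steps inside
   [perp S]. *)
suff H k (S : T -> Prop) : issub S -> lge n S -> lge k (perp S) -> lge (n + k) (@full R (dual T)).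
  by move=> ln; rewrite -[n]addn0; apply: (H 0%N (@full R T)).
elim: n k S => [|n IHn] k S sS; first by move=> _; apply: lge_mono.
move=> [S' [sS' S'S [x [Sx S'x]] ln]] lk; rewrite addSnnS; apply: (IHn _ S') => //.
exists (perp S); split=> //.
- split=> [y _|a h h' h0 h0' y Sy]; first by rewrite hom0.
  by rewrite homD homZ h0 // h0' // scaler0 addr0.
- by move=> h h0 y /S'S/h0.
have [Q [q [qs qk]]] := quot_exists sS'.
have [|f fx] := nonzero_functional sg (v := q x); first by move/qk.
have [h hE] := hom_of_linear (f \o q); exists h; split.
  by move=> y /qk qy; rewrite hE /= qy linear0.
by move=> /(_ x Sx); rewrite hE.
Qed.

(** Since m T = 0, a functional takes values in soc R = R s, of length 1; by injectivity of R its
    values on a basis of T can be prescribed there. *)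
Lemma len_dual (T : lmodType R) : annihilated m T -> finlen (@full R (dual T)) ->
  finlen (@full R T) /\ len (@full R (dual T)) = len (@full R T).
Proof.
move=> annT fD; have [fT _] := len_le (@lge_dual T) fD; split=> //.
have socT (v : T) : soc m v by move=> a; apply: annT.
have [x [_ xg xi]] := basis_exists (sg_unit sg) (issub_full T) fT (fun v _ => socT v).
have /choice[g gE] : forall j, exists g : {linear dual T -> R^o},
    forall h, g h = submod_val h (x j) by move=> j; apply: hom_eval.
pose S (y : R^o) := exists r : R, y = r * s.
have sS : issub S by apply: issub_principal.
have [fS _] := len_sub (S := S) (T := @full R R^o) (fun _ _ => I) (sg_fin sg).
have [|||_ ->] := len_power (g := g) (S := @full R (dual T)) (issub_full _) sS fS.
- move=> h _ j; rewrite gE; apply: (sg_soc sg) => a am.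
  have [l lE] := hom_linear h; rewrite -lE.
  have <- : l (a *: x j) = a * l (x j) by apply: linearZ.
  by rewrite annT // linear0.
- move=> t tS; have [|f fE] := injective_ext (h := comb x) (f := comb t : {linear _ -> R^o}) (sg_inj sg).
    move=> w /xi wm; rewrite /= /comb big1 // => j _.
    have [r ->] := tS j; rewrite /GRing.scale /= mulrCA (m_s sg) ?mulr0 //.
  have [h hE] := hom_of_linear f; exists h; split=> // j.
  by rewrite gE hE -(comb_delta x j) fE; apply: comb_delta.
- move=> h _ h0; apply: hom_ext => v; have [w ->] := xg v I.
  have [l lE] := hom_linear h; rewrite -lE linear_comb /comb big1 // => j _.
  by rewrite lE -gE h0 scaler0.
by rewrite (sg_lens sg) muln1.
Qed.

Lemma Tor_eventually M (P : proj_resolution M) N :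
  finlen (@full R M) -> finlen (@full R N) ->
  exists i0, forall i, (i0 <= i)%N ->
  [/\ annihilated m (Tor P N i), finlen (@full R (Tor P N i))
    & (len (@full R (Tor P N i)) + len (@full R (Tor P N i.+2))
       = e * len (@full R (Tor P N i.+1)))%N].
Proof.
move=> fM fN; have fD : finlen (@full R (dual N)).
  have [p [q ss]] : exists b (q : {linear 'rV[R]_b -> N}), surjf q.
    have [c] := cover_exists sg (exist _ N fN); have [_ cs _] := cov_ses c.
    by exists (cov_rank c), (cov_p c).
  have [Q QE] : exists Q : {linear dual N -> dual 'rV[R]_p},
      forall h v, submod_val (Q h) v = submod_val h (q v) by exists (hom_map _ q).
  apply: (finlen_inj_full (f := Q)).
    by move=> h Qh; apply: hom_ext => x; have [v <-] := ss x; rewrite -QE Qh.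
  by have [] := @len_hom_free R p R^o (@full R _) (@full R _) (issub_full _) (issub_full _) (sg_fin sg).
(* [Tor_dual] concerns positive degrees, hence the shift of the bound by one. *)
have [i0 i0P] := Ext_eventually sg P fM fD; exists i0.+1.
have TE i : (i0 <= i)%N -> [/\ annihilated m (Tor P N i.+1), finlen (@full R (Tor P N i.+1))
    & len (@full R (Tor P N i.+1)) = len (@full R (Ext P (dual N) i.+1))].
  move=> ii; have [annE fE _] := i0P i.+1 (leqW ii).
  have iso := Tor_dual (sg_inj sg) N P i.
  have annT := annihilated_dual (iso_annihilated (iso_sym iso) annE).
  have [fT lT] := iso_len iso fE.
  by have [fT' lT'] := len_dual annT fT; rewrite -lT' lT.
case=> // i ii; have [annT fT ->] := TE i ii; split=> //.
have [_ _ ->] := TE i.+1 (leqW ii); have [_ _ ->] := TE i.+2 (leqW (leqW ii)).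
by have [_ _] := i0P i.+1 (leqW ii).
Qed.

End DualLength.

(** The coefficient of t^(n+2) in the product is f n - e f (n+1) + f (n+2), so nothing survives from
    degree i0 + 2 on. *)
Lemma is_poly_recurrence (e : nat) (f : nat -> nat) i0 :
  (forall i, (i0 <= i)%N -> (f i + f i.+2 = e * f i.+1)%N) ->
  is_poly (fps_mul (fps_of_poly (1 - e%:R *: 'X + 'X^2)) (fun i => (f i)%:Z)).
Proof.
move=> rec; set g := fps_mul _ _.
exists (\poly_(i < i0.+2) g i) => n; rewrite /fps_of_poly coef_poly.
case: ltnP => // ni; case: n ni => [//|[//|n]] ni.
rewrite /g /fps_mul /fps_of_poly.
rewrite big_ord_recl big_ord_recl big_ord_recl big1 => [|i _].
  rewrite !coefE /= !subn0 /bump /= !subSS subn0.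
  have /(congr1 Posz) := rec n ni; rewrite subn0 natz PoszD PoszM => recn.
  by transitivity ((f n)%:Z + (f n.+2)%:Z - e%:Z * (f n.+1)%:Z); [ring|rewrite recn subrr].
by rewrite !coefE /= !subr0 ?mulr0 ?addr0 ?mul0r.
Qed.

(** * Self-injectivity, socle and length of the ring *)

Section RingFacts.
Variables (R : comNzRingType) (m : submodClosed R^o) (e : nat).

Lemma short_gorenstein_exists :
  maximal_ideal m -> gorenstein R ->
  (forall x : R^o, x \in prod_submod m (prod_submod m m) -> x = 0) ->
  (exists x : R^o, x \in prod_submod m m /\ x <> 0) ->
  e = nu m (submod m) -> (2 < e)%N -> exists s, short_gorenstein m s e.
Proof.
move=> [m1 mmax] gorR m3_eq0 [x0 [x0m x0_neq0]] e_def e_gt2.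
have m3 (a b c : R) : a \in m -> b \in m -> c \in m -> a * b * c = 0.
  move=> am bm cm; apply: m3_eq0; rewrite -mulrA; apply: span_gen.
  by exists a, (b * c); split=> //; apply: span_gen; exists b, c.
have m_unit (u : R) : u \notin m -> exists v : R, v * u = 1.
  move=> um; pose J := span (fun x : R^o => x \in m \/ x = u).
  have mJ : {subset m <= J} by move=> x xm; apply: span_gen; left.
  have uJ : u \in J by apply: span_gen; right.
  have J1 : (1 : R^o) \in J.
    by apply/negPn/negP => /mmax/(_ mJ) Jm; move: um; rewrite -Jm uJ.
  have sA : issub (fun x : R^o => exists (a r : R), a \in m /\ x = a + r * u).
    split=> [|c _ _ [a [r [am ->]]] [b [t [bm ->]]]].
      by exists 0, 0; rewrite mul0r addr0; split=> //; apply: rpred0.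
    exists (c * a + b), (c * r + t); split; first exact: ((issub_closed m).2 c).
    by rewrite /GRing.scale /=; ring.
  have [x [xm|->]|a [r [am ar1]]] := span_min sA _ J1.
  - by exists x, 0; rewrite mul0r addr0.
  - by exists 0, 1; rewrite mul1r add0r; split=> //; apply: rpred0.
  (* Geometric series: 1 + a + a^2 inverts 1 - a because a^3 = 0. *)
  exists ((1 + a + a * a) * r); rewrite -mulrA.
  have -> : r * u = 1 - a by rewrite ar1; ring.
  have -> : (1 + a + a * a) * (1 - a) = 1 - a * a * a by ring.
  by rewrite m3 // subr0.
have [a0 [b0 [am bm ab0]]] : exists a b : R, [/\ a \in m, b \in m & a * b <> 0].
  apply: contrapT => nab; apply: x0_neq0.
  apply: (span_min (issub_zero R^o) _ x0m) => _ [a [b [am bm ->]]].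
  by apply: contrapT => ab; apply: nab; exists a, b.
(* Any nonzero product of two elements of m has annihilator m, which is what [self_injective] asks
   of s; that s spans the socle is then deduced from injectivity. *)
pose s := a0 * b0; exists s.
have ms (a : R) : a \in m -> a * s = 0 by move=> aam; rewrite mulrA m3.
have sm (a : R) : a * s = 0 -> a \in m.
  move=> as0; apply: contrapT => /negP/m_unit[v va]; apply: ab0.
  by rewrite -/s -[s]mul1r -va -mulrA as0 mulr0.
have injR := self_injective m_unit m3 ms sm gorR.
(* As m kills [x], the map r s -> r x is well defined on R s; it extends to an endomorphism of R,
   which is multiplication by its value at 1. *)
have socs (x : R) : (forall a : R, a \in m -> a * x = 0) -> exists r, x = r * s.
  move=> mx; have lm (y : R) : linear (fun a : R^o => (a * y : R^o)).
    by move=> a u v; rewrite mulrDl scalerAl.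
  have [h hE] := linear_exists (lm s); have [f fE] := linear_exists (lm x).
  have [a|g gE] := injective_ext (h := h) (f := f) injR.
    by rewrite hE fE => /sm/mx.
  exists (g 1); have := gE 1; rewrite hE fE !mul1r => <-; rewrite [RHS]mulrC.
  have <- : g (s *: (1 : R^o)) = s * g 1 by apply: linearZ.
  by rewrite /GRing.scale /= mulr1.
pose S (y : R^o) := exists r : R, y = r * s.
have sS : issub S by apply: issub_principal.
have [fS lS] : finlen S /\ len S = 1%N.
  apply: (@len_simple R R^o S s) => //; first by exists 1; rewrite mul1r.
  move=> _ [r ->] r0 _ [t ->]; have [rm|/m_unit[u ur]] := boolP (r \in m).
    by case: r0; apply: ms.
  by exists (t * u); rewrite /GRing.scale /= [RHS]mulrA -[t * u * r]mulrA ur mulr1.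
have Sm y : S y -> y \in m.
  by move=> [r ->]; have := issubZ (issub_closed m) (r * a0) bm; rewrite /GRing.scale /= -mulrA.
(* The length of m is 1 + e, from 0 -> R s -> m -> m/m^2 -> 0. *)
pose Q : lmodType R := quot_mod (prod_submod m (@predT (submod m))).
(* [nu] has default value 0, which e > 2 excludes, so m/m^2 does have a basis with [e] elements. *)
have [b bE] : exists b : 'I_e -> Q, residue_basis m b.
  by move: e_gt2; rewrite e_def /nu; case: xgetP.
pose q : {linear submod m -> Q} := to_quot (prod_submod m (@predT (submod m))).
have qs : surjf q by move=> t; exists (quot_repr t); apply: to_quotK.
pose K : submod m -> Prop := fun v => v \in prod_submod m (@predT (submod m)).
have qk v : q v = 0 <-> K v.
  suff -> : q v = 0 <-> v - 0 \in prod_submod m (@predT (submod m)) by rewrite subr0.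
  by rewrite -to_quot_eq -(linear0 q).
have socQ (y : Q) : soc m y.
  move=> a aam; have [v <-] := qs y; rewrite -linearZ; apply/qk/span_gen.
  by exists a, v.
pose i : {linear submod m -> R^o} := val.
have ii : injf i by move=> u u0; apply: val_inj.
have sK : issub K by apply: issub_closed.
(* This is m^2 = R s: products of two elements of m are killed by m, hence lie in the socle, and s
   is itself such a product. *)
have iK y : imsub i K y <-> S y.
  split=> [[v [vm <-]]|[r ->]].
    have := span_min (issub_pre i sS) _ vm; apply => _ [a [x [aam _ ->]]].
    apply: socs => c cm; rewrite /i /= /GRing.scale /= mulrA m3 //; exact: (valP x).
  exists ((r * a0) *: Submod bm); split; last by rewrite /i /= /GRing.scale /= -mulrA.
  by apply: span_gen; exists (r * a0), (Submod bm); split=> //; have := issubZ (issub_closed m) r am.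
have fK : finlen K.
  apply: (finlen_inj (f := i)) => // [v _ /ii//|].
  by apply: finlen_ext fS => y; rewrite iK.
have lK : len K = 1%N.
  rewrite -(len_imsub_inj (f := i) sK fK) => [|v _ /ii//].
  by rewrite -lS; apply: len_ext.
have fQ : finlen (@full R Q).
  apply: (finlen_generated m_unit (x := b) socQ) => v; have [c ->] := bE.1 v.
  by exists (\row_j c j); apply: eq_bigr => j _; rewrite mxE.
have kq v : K v <-> kersub q (@full _ _) v.
  by rewrite -qk; split=> [|[]].
have [fM lM] : finlen (@full R (submod m)) /\ len (@full R (submod m)) = (1 + len (@full R Q))%N.
  rewrite -(imsub_full qs) -{1}lK (len_ext kq); apply: len_add => //.
    exact: finlen_ext fK.
  by rewrite (imsub_full qs).
have iM y : imsub i (@full _ _) y <-> y \in m.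
  by split=> [[v [_ <-]]|ym]; [apply: (valP v)|exists (Submod ym)].
have fm : finlen (fun y : R^o => y \in m).
  by apply: (finlen_ext iM); apply: finlen_im.
have lm : len (fun y : R^o => y \in m) = (1 + len (@full R Q))%N.
  by rewrite -lM -(len_ext iM) len_imsub_inj // => v _ /ii.
have [k [p [ps pk]]] := quot_exists (issub_closed m).
have pm y : y \in m <-> kersub p (@full _ _) y by rewrite -pk; split=> [|[]].
have [fk lk] : finlen (@full R k) /\ len (@full R k) = 1%N.
  apply: (@len_simple R k (@full R k) (p 1)) => // [/pk //|v _ v0 w _]; first by apply/negP.
  have [x xE] := ps v; have [y <-] := ps w; subst v.
  have /m_unit[u ux] : x \notin m by apply/negP => /pk.
  exists (y * u); rewrite -linearZ; congr (p _).
  by rewrite /GRing.scale /= -mulrA ux mulr1.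
have [fR lR] : finlen (@full R R^o) /\
    len (@full R R^o) = (len (fun y : R^o => y \in m) + 1)%N.
  rewrite -lk -(imsub_full ps) (len_ext pm); apply: len_add => //.
    exact: finlen_ext fm.
  by rewrite (imsub_full ps).
rewrite addn1 in lR; have [_ lQ] := residue_basis_len fR lR socQ bE.
split=> //; [by exists a0, b0|by rewrite lR lm lQ|by rewrite lm lQ].
Qed.

End RingFacts.

Lemma fin_gen_finlen (R : comNzRingType) (V : lmodType R) :
  finlen (@full R R^o) -> fin_gen (@predT V) -> finlen (@full R V).
Proof.
move=> finR [r rE]; pose x (i : 'I_(size r)) := nth 0 r i.
have [fF _] := len_coord (size r) finR (issub_full R^o).
have sI := issub_im (comb x) (issub_full 'rV[R]_(size r)).
have xs : surjf (comb x).
  move=> v; have vr : v \in span (fun u => u \in r) by rewrite -rE.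
  have [w [_ <-]] : imsub (comb x) (@full _ _) v; last by exists w.
  apply: (span_min sI _ vr) => u ur.
  have lt : (index u r < size r)%N by rewrite index_mem.
  exists (delta_mx 0 (Ordinal lt)); split=> //.
  by transitivity (x (Ordinal lt)); [apply: comb_delta|apply: nth_index].
have {}fF : finlen (@full R 'rV[R]_(size r)) by apply: finlen_ext fF.
by rewrite -(imsub_full xs); apply: finlen_im.
Qed.

Lemma annihilated_is_poly (R : comNzRingType) (m : submodClosed R^o) (s : R) (e : nat)
    (T : nat -> lmodType R) : short_gorenstein m s e ->
  (exists i0, forall i, (i0 <= i)%N ->
    [/\ annihilated m (T i), finlen (@full R (T i))
      & (len (@full R (T i)) + len (@full R (T i.+2)) = e * len (@full R (T i.+1)))%N]) ->
  (exists i0, forall i, (i0 <= i)%N -> annihilated m (T i)) /\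
  is_poly (fps_mul (fps_of_poly (1 - e%:R *: 'X + 'X^2)) (fun i => (nu m (T i))%:Z)).
Proof.
move=> sg [i0 TP]; split; first by exists i0 => i /TP[].
have lenR : len (@full R R^o) = (len (fun x : R^o => x \in m)).+1.
  by rewrite (sg_len sg) (sg_lenm sg).
have nuT i : (i0 <= i)%N -> nu m (T i) = len (@full R (T i)).
  by move=> /TP[annT fT _]; apply: (nuE (sg_unit sg) (sg_fin sg)).
apply: (@is_poly_recurrence e (fun i => nu m (T i)) i0) => i ii.
rewrite !nuT //; last by apply: leqW; apply: leqW.
  by have [] := TP i ii.
exact: leqW.
Qed.

Theorem theorem3p1 (R : comNzRingType) (m : submodClosed R^o) (e : nat)
    (M N : lmodType R) (P : proj_resolution M)
    (noethR : noetherian R)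
    (localR : local_ring m)
    (gorR : gorenstein R)
    (m3_eq0 : forall x : R^o, x \in prod_submod m (prod_submod m m) -> x = 0)
    (m2_neq0 : exists x : R^o, x \in prod_submod m m /\ x <> 0)
    (e_def : e = nu m (submod m))
    (e_gt2 : (2 < e)%N)
    (fgM : fin_gen (@predT M))
    (fgN : fin_gen (@predT N)) :
  [/\ exists i0 : nat, forall i, (i0 <= i)%N -> annihilated m (Tor P N i),
      exists i0 : nat, forall i, (i0 <= i)%N -> annihilated m (Ext P N i),
      is_poly (fps_mul (fps_of_poly (1 - e%:R *: 'X + 'X^2))
                       (fun i => (nu m (Tor P N i))%:Z))
    & is_poly (fps_mul (fps_of_poly (1 - e%:R *: 'X + 'X^2))
                       (fun i => (nu m (Ext P N i))%:Z))].
Proof.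
have [s sg] := short_gorenstein_exists localR.1 gorR m3_eq0 m2_neq0 e_def e_gt2.
have fM := fin_gen_finlen (sg_fin sg) fgM; have fN := fin_gen_finlen (sg_fin sg) fgN.
have [annTor polyTor] := annihilated_is_poly sg (Tor_eventually sg P fM fN).
by have [annExt polyExt] := annihilated_is_poly sg (Ext_eventually sg P fM fN).
Qed.
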